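(* $f\in H^{-1}_W(\mathbb T^d)$ if and only if there exist functions $f_0\in L^2(\mathbb T^d)$ and $f_k\in L^2_{x^k\otimes W_k,0}(\mathbb T^d)$, $k=1,\dots,d$, such that $$f=f_0-\sum_{i=1}^d\partial_{x_i}f_i,\qquad( * )$$ in the sense that for every $v\in H_{1,W}(\mathbb T^d)$ $$(f,v)=\int_{\mathbb T^d}f_0v\,dx+\sum_{i=1}^d\int_{\mathbb T^d}f_i\,(\partial_{W_i}v)\,d(x^i\otimes W_i).$$ Furthermore, $$\|f\|_{H^{-1}_W}=\inf\left\{\left(\int_{\mathbb T^d}|f_0|^2\,dx+\sum_{i=1}^d\int_{\mathbb T^d}|f_i|^2\,d(x^i\otimes W_i)\right)^{1/2}:\ f\text{ satisfies }( * )\right\}.$$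
   Context: $\mathbb T=\mathbb R/\mathbb Z=[0,1)$ and $\mathbb T^d=[0,1)^d$. $W(x)=\sum_{k=1}^dW_k(x_k)$, where each $W_k:\mathbb R\to\mathbb R$ is strictly increasing, right continuous with left limits, and satisfies $W_k(u+1)-W_k(u)=W_k(1)-W_k(0)$ for all $u$. $dW_k$ is the measure induced by $W_k$ on $\mathbb T$. The generalized derivative is $\partial_{W_k}f(x)=\lim_{\epsilon\to0}\frac{f(x+\epsilon e_k)-f(x)}{W_k(x_k+\epsilon)-W_k(x_k)}$ when the limit exists and is finite. One-dimensional operator: $\mathcal D_{W_k}$ is the set of $f\in L^2(\mathbb T)$ of the form $f(x)=a+bW_k(x)+\int_{(0,x]}W_k(dy)\int_0^y\mathfrak f(z)\,dz$ with $\mathfrak f\in L^2(\mathbb T)$, $\int_0^1\mathfrak f(z)\,dz=0$ and $\int_{(0,1]}W_k(dy)\{b+\int_0^y\mathfrak f(z)\,dz\}=0$; on $\mathcal D_{W_k}$, $\mathcal L_{W_k}f=\partial_{x_k}\partial_{W_k}f$ (with $\partial_{W_k}f(x)=b+\int_0^x\mathfrak f(z)\,dz$ and $\mathcal L_{W_k}f=\mathfrak f$). $\mathcal A_{W_k}$ is a countable complete orthonormal system of $L^2(\mathbb T)$ consisting of eigenvectors of $\mathcal L_{W_k}$. $\mathcal A_W=\{f:\ f(x)=\prod_{k=1}^df_k(x_k),\ f_k\in\mathcal A_{W_k}\}$ and $\mathbb D_W=\mathrm{span}(\mathcal A_W)$. For $f\in\mathbb D_W$, $\partial_{W_i}f$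 and $\partial_{x_i}\partial_{W_i}f$ act on the $i$th coordinate with the others fixed. $d(x^i\otimes W_i)=dx_1\cdots dx_{i-1}\,dW_i\,dx_{i+1}\cdots dx_d$ on $\mathbb T^d$; $L^2_{x^i\otimes W_i}(\mathbb T^d)$ is the corresponding $L^2$ space, and $L^2_{x^i\otimes W_i,0}(\mathbb T^d)$ is its closed subspace of functions $f$ with zero mean, $\int_{\mathbb T^d}f\,d(x^i\otimes W_i)=0$. The $W$-Sobolev space $H_{1,W}(\mathbb T^d)$ is the set of $g\in L^2(\mathbb T^d)$ such that for each $i=1,\dots,d$ there is $G_i\in L^2_{x^i\otimes W_i,0}(\mathbb T^d)$ with $\int_{\mathbb T^d}(\partial_{x_i}\partial_{W_i}f)\,g\,dx=-\int_{\mathbb T^d}(\partial_{W_i}f)\,G_i\,d(x^i\otimes W_i)$ for all $f\in\mathbb D_W$; the (unique) $G_i$ is denoted $\partial_{W_i}g$. Its norm $\|\cdot\|_{1,W}$ is induced by $\langle f,g\rangle_{1,W}=\int_{\mathbb T^d}fg\,dx+\sum_{i=1}^d\int_{\mathbb T^d}(\partial_{W_i}f)(\partial_{W_i}g)\,d(x^i\otimes W_i)$. $H^{-1}_W(\mathbb T^d)$ is the dual of $H_{1,W}(\mathbb T^d)$ (the set of bounded linear functionals on it), with dual norm $\|\cdot\|_{H^{-1}_W}$, and $(\cdot,\cdot)$ is the pairing between $H^{-1}_W(\mathbb T^d)$ and $H_{1,W}(\mathbb T^d)$.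
   Formalization: For d ≥ 2 the weak derivative ∂_{W_i}g is not unique (for g = 0, any mean-zero function of the other coordinates also qualifies), so ∂_{W_i}g is taken to be the G_i of least norm in L²_{x^i⊗W_i}; for d = 1 this is the original definition. *)

(* Defs.v *)
From HB Require Import structures.
From mathcomp Require Import all_boot all_order all_algebra.
From mathcomp Require Import all_classical all_reals all_analysis.

Set Implicit Arguments.
Unset Strict Implicit.
Unset Printing Implicit Defensive.
Import Order.TTheory GRing.Theory Num.Theory.
Import numFieldNormedType.Exports.

Local Open Scope classical_set_scope.
Local Open Scope ring_scope.

Section tuple_measure.
Context {dT} {T : measurableType dT} {R : realType}.
Local Open Scope ereal_scope.

Definition cons_pair n (p : T * n.-tuple T) : n.+1.-tuple T :=
  [tuple of p.1 :: p.2].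

Lemma measurable_cons_pair n : measurable_fun setT (@cons_pair n).
Proof.
exact: (@measurable_cons _ _ _ _ fst n snd measurable_fst measurable_snd).
Qed.

HB.instance Definition _ n :=
  isMeasurableFun.Build _ _ _ _ (@cons_pair n) (@measurable_cons_pair n).

Section step.
Variables (n : nat) (m1 : {finite_measure set T -> \bar R})
  (m2 : {finite_measure set (n.-tuple T) -> \bar R}).

Definition tuple_measureS : set (n.+1.-tuple T) -> \bar R :=
  pushforward (m1 \x m2) (@cons_pair n).

Let tuple_measureS0 : tuple_measureS set0 = 0.
Proof. exact: measure0. Qed.

Let tuple_measureS_ge0 A : 0 <= tuple_measureS A.
Proof. exact: measure_ge0. Qed.

Let tuple_measureS_sigma_additive : semi_sigma_additive tuple_measureS.
Proof. exact: measure_semi_sigma_additive. Qed.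

HB.instance Definition _ := isMeasure.Build _ _ _ tuple_measureS
  tuple_measureS0 tuple_measureS_ge0 tuple_measureS_sigma_additive.

Let tuple_measureS_fin : fin_num_fun tuple_measureS.
Proof.
move=> A mA; rewrite ge0_fin_numE//.
apply: (@le_lt_trans _ _ (tuple_measureS setT)).
  by apply: le_measure; rewrite ?inE.
rewrite /tuple_measureS /pushforward preimage_setT -setXTT.
rewrite [ltLHS]product_measure1E// lte_mul_pinfty//.
  exact: fin_num_measure.
by rewrite -ge0_fin_numE//; exact: fin_num_measure.
Qed.

HB.instance Definition _ :=
  Measure_isFinite.Build _ _ _ tuple_measureS tuple_measureS_fin.

End step.

(* The product of mu 0, ..., mu (n - 1), on n-tuples. *)
Fixpoint tuple_measure n :
    ('I_n -> {finite_measure set T -> \bar R}) ->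
    {finite_measure set (n.-tuple T) -> \bar R} :=
  match n return ('I_n -> {finite_measure set T -> \bar R}) ->
                 {finite_measure set (n.-tuple T) -> \bar R} with
  | 0 => fun=> [the {finite_measure set (0.-tuple T) -> \bar R} of
                  \d_ ([tuple] : 0.-tuple T)]
  | n.+1 => fun mu => [the {finite_measure set (n.+1.-tuple T) -> \bar R} of
      tuple_measureS (mu ord0) (tuple_measure (fun k => mu (lift ord0 k)))]
  end.

Let measurable_box n (B : 'I_n -> set T) : (forall k, measurable (B k)) ->
  measurable [set x : n.-tuple T | forall k, B k (tnth x k)].
Proof.
move=> mB; rewrite (_ : [set _ | _] =
    \big[setI/setT]_(k < n) ((fun x : n.-tuple T => tnth x k) @^-1` B k)).
  apply: bigsetI_measurable => k _; rewrite -[X in measurable X]setTI.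
  exact: measurable_tnth.
rewrite -bigcap_seq; apply/seteqP; split => [x Bx k _|x Bx k]; first exact: Bx.
by apply: Bx; rewrite /= mem_index_enum.
Qed.

Lemma tuple_measureE n (mu : 'I_n -> {finite_measure set T -> \bar R})
    (B : 'I_n -> set T) : (forall k, measurable (B k)) ->
  tuple_measure mu [set x | forall k, B k (tnth x k)] = \prod_(k < n) mu k (B k).
Proof.
elim: n mu B => [|n IHn] mu B mB.
  rewrite big_ord0 /= diracE.
  suff -> : [set x : 0.-tuple T | forall k, B k (tnth x k)] = setT.
    by rewrite in_setT.
  by apply/seteqP; split => // x _ [].
rewrite big_ord_recl -IHn//= /tuple_measureS /pushforward.
have mB' := @measurable_box n (fun k => B (lift ord0 k)) (fun k => mB _).
rewrite -(product_measure1E _ _ (mB ord0) mB').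
congr (_ _); apply/seteqP; split => [[a x]/= Bx|[a x]/= [Ba Bx] k].
  split=> [|k]; first exact: (Bx ord0).
  by have := Bx (lift ord0 k); rewrite tnthS.
by case: (unliftP ord0 k) => [j ->|->//]; rewrite tnthS; exact: Bx.
Qed.

End tuple_measure.

(* The torus T = R/Z is represented by [0, 1[: a function on T^d is a function
   on d-tuples of reals of which only the values on [0, 1[^d matter, since the
   measures below are carried by [0, 1[ (resp. [0, 1[^d). *)
Section torus_measure.
Context {R : realType}.

(* The measure dV on T, for V with periodic increments (so that the mass
   V 0 - V 0^- of the point 0 of T is also the jump of V at 1). *)
Definition torus_measure (V : cumulative R R) :
    set (measurableTypeR R) -> \bar R :=
  mrestr (lebesgue_stieltjes_measure V) (measurable_itv `[0, 1[).

HB.instance Definition _ (V : cumulative R R) :=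
  Measure.on (torus_measure V).

Let torus_measure_fin (V : cumulative R R) : fin_num_fun (torus_measure V).
Proof.
move=> A mA; rewrite ge0_fin_numE//.
have mI : measurable (`]-1, 1] : set (measurableTypeR R)).
  exact: measurable_itv.
apply: (@le_lt_trans _ _ (lebesgue_stieltjes_measure V `]-1, 1])).
  rewrite /torus_measure /mrestr; apply: le_measure; rewrite ?inE//.
    by apply: measurableI => //; exact: measurable_itv.
  move=> x [_] /=; rewrite !in_itv/= => /andP[x0 x1].
  by rewrite (ltW x1) (lt_le_trans _ x0)// oppr_lt0.
rewrite /lebesgue_stieltjes_measure /measure_extension measurable_mu_extE/=.
  by rewrite wlength_itv_bnd ?ltry// (le_trans (lerN10 R)).
exact: is_ocitv.
Qed.

HB.instance Definition _ (V : cumulative R R) :=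
  Measure_isFinite.Build _ _ _ (torus_measure V) (@torus_measure_fin V).

End torus_measure.

(* Lebesgue measure on T; lebesgue_measure is by definition
   lebesgue_stieltjes_measure idfun. *)
Notation torus_dx R := (torus_measure (@idfun R)).

Section one_dimensional.
Context {R : realType}.
Implicit Types (W : cumulative R R) (f ff h : R -> R).

(* Right continuity is part of the structure cumulative. *)
Definition strict_periodic_increments W :=
  [/\ {homo W : u v / u < v},
      forall u, cvg (W v @[v --> u^'-]) &
      forall u, W (u + 1) - W u = W 1 - W 0].

(* f belongs to the domain D_W and L_W f = ff. An element of D_W is an L^2
   class; f is its right-continuous representative, the one the formula gives. *)
Definition LW_graph W f ff :=
  [/\ f \in Lfun (torus_dx R) 2%:E,
      ff \in Lfun (torus_dx R) 2%:E,
      \int[torus_dx R]_z ff z = 0 &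
      exists a b : R,
        \int[lebesgue_stieltjes_measure W]_(y in `]0, 1])
          (b + \int[lebesgue_measure]_(z in `[0, y]) ff z) = 0 /\
        forall x, x \in `[0, 1[ ->
          f x = a + b * W x +
            \int[lebesgue_stieltjes_measure W]_(y in `]0, x])
              \int[lebesgue_measure]_(z in `[0, y]) ff z].

Definition LW_eigenvector W f :=
  (exists lam : R, exists2 ff, LW_graph W f ff &
    {ae torus_dx R, forall x, ff x = lam * f x}) /\
  ~ {ae torus_dx R, forall x, f x = 0}.

(* A is a countable complete orthonormal system of L^2(T) consisting of
   eigenvectors of L_W. *)
Definition eigenbasis W (A : set (R -> R)) :=
  [/\ countable A,
      forall f, A f -> LW_eigenvector W f,
      forall f, A f -> \int[torus_dx R]_x (f x * f x) = 1,
      forall f g, A f -> A g -> f <> g -> \int[torus_dx R]_x (f x * g x) = 0 &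
      forall h, h \in Lfun (torus_dx R) 2%:E ->
        (forall f, A f -> \int[torus_dx R]_x (h x * f x) = 0) ->
        {ae torus_dx R, forall x, h x = 0}].

End one_dimensional.

Section W_Sobolev.
Context {R : realType} (d : nat).
Variables (W : 'I_d -> cumulative R R) (A : 'I_d -> set (R -> R)).
Local Notation point := (d.-tuple (measurableTypeR R)).
Implicit Types (f g G v w : point -> R) (F : (point -> R) -> R) (x : point).

Definition dx : {finite_measure set point -> \bar R} :=
  tuple_measure (fun=> torus_dx R).

(* d(x^i \otimes W_i) *)
Definition dxW (i : 'I_d) : {finite_measure set point -> \bar R} :=
  tuple_measure (fun k => torus_measure
    (if k == i then W k else [the cumulative R R of idfun])).

Definition L2 f := f \in Lfun dx 2%:E.

(* L^2_{x^i \otimes W_i, 0} *)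
Definition L2W0 i f := f \in Lfun (dxW i) 2%:E /\ \int[dxW i]_x f x = 0.

(* x + e e_i in T^d, for x in [0, 1[^d *)
Definition torus_shift i (e : R) x : point :=
  [tuple if k == i then tnth x k + e - (Num.floor (tnth x k + e))%:~R
         else tnth x k | k < d].

(* The generalized derivative in the i-th coordinate with respect to V: this is
   \partial_{W_i} for V = W i, and \partial_{x_i} for V = idfun. As usual, lim
   is a default value where the limit does not exist; for f in DW below,
   gderiv (W i) i f is a true limit everywhere on [0, 1[^d and
   gderiv idfun i (gderiv (W i) i f) is one almost everywhere. *)
Definition gderiv (V : R -> R) i f x : R :=
  lim ((f (torus_shift i e x) - f x) / (V (tnth x i + e) - V (tnth x i))
       @[e --> 0^']).

Definition AW : set (point -> R) :=
  [set f | exists2 phi : 'I_d -> R -> R, (forall k, A k (phi k)) &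
    f = fun x => \prod_(k < d) phi k (tnth x k)].

Definition DW : set (point -> R) :=
  [set f | exists n (c : 'I_n -> R) (u : 'I_n -> point -> R),
    (forall j, AW (u j)) /\ f = fun x => \sum_(j < n) c j * u j x].

Definition weak_deriv i g G :=
  L2W0 i G /\
  forall f, DW f ->
    \int[dx]_x (gderiv idfun i (gderiv (W i) i f) x * g x) =
    - \int[dxW i]_x (gderiv (W i) i f x * G x).

Definition H1W : set (point -> R) :=
  [set g | L2 g /\ forall i, exists G, weak_deriv i g G].

(* The weak derivative \partial_{W_i} g. For d = 1 all the G such that
   weak_deriv i g G agree almost everywhere and the minimality clause is void.
   For d >= 2 they do not: every mean-zero L^2 function of the coordinates other
   than the i-th is a G for g = 0. The G of least norm is the one in the closed
   span of the gderiv (W i) i f, f in DW; it is unique up to null sets and linear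
   in g, and it is gderiv (W i) i g when g is in DW. *)
Definition wderiv i g : point -> R :=
  get [set G | weak_deriv i g G /\
    forall G', weak_deriv i g G' ->
      \int[dxW i]_x (G x * G x) <= \int[dxW i]_x (G' x * G' x)].

Definition ip1W g v : R :=
  \int[dx]_x (g x * v x) +
  \sum_(i < d) \int[dxW i]_x (wderiv i g x * wderiv i v x).

Definition norm1W g : R := Num.sqrt (ip1W g g).

(* F, as a functional on H_{1,W}, is in H^{-1}_W; the values of F outside of
   H1W are irrelevant, and boundedness makes F invariant under a.e. equality. *)
Definition Hm1W F :=
  (forall (a : R) v w, H1W v -> H1W w ->
     F (fun x => a * v x + w x) = a * F v + F w) /\
  (exists C : R, forall v, H1W v -> `|F v| <= C * norm1W v).

Definition normHm1W F : R :=
  sup [set `|F v| | v in [set v | H1W v /\ norm1W v <= 1]].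

(* F = f0 - \sum_i \partial_{x_i} f_i *)
Definition represents F (f0 : point -> R) (f : 'I_d -> point -> R) :=
  [/\ L2 f0, forall k, L2W0 k (f k) &
    forall v, H1W v ->
      F v = \int[dx]_x (f0 x * v x) +
            \sum_(i < d) \int[dxW i]_x (f i x * wderiv i v x)].

Definition repr_norm (f0 : point -> R) (f : 'I_d -> point -> R) : R :=
  Num.sqrt (\int[dx]_x `|f0 x| ^+ 2 +
            \sum_(i < d) \int[dxW i]_x `|f i x| ^+ 2).

End W_Sobolev.

(* Main.v *)
(* H_{1,W} is a Hilbert space: g |-> (g, grad g) embeds it isometrically in
   L^2(dx) x \prod_i L^2(d(x^i \otimes W_i)), and its image is closed because
   being a weak derivative, and being orthogonal to the differences of weak
   derivatives of a given function (which characterizes the weak derivative of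
   least norm), are stated by means of scalar products with fixed L^2 functions.
   That the derivatives of the test functions in D_W are (almost everywhere
   equal to) L^2 functions comes from the explicit form of the domain of L_W:
   \partial_W f is the bounded function b + \int_0^x ff, and its derivative is
   ff almost everywhere by Lebesgue's differentiation theorem.
   The Riesz representative u of a functional F gives the representation
   f0 = u, f_i = grad_i u of F, whose norm is that of F; by the Cauchy-Schwarz
   inequality no representation has a smaller norm. *)
Require Import Defs.
From HB Require Import structures.
From mathcomp Require Import all_boot all_order all_algebra.
From mathcomp Require Import all_classical all_reals all_analysis.
From mathcomp Require Import measurable_realfun ring lra.

Set Implicit Arguments.
Unset Strict Implicit.
Unset Printing Implicit Defensive.
Import Order.TTheory GRing.Theory Num.Theory.
Import numFieldNormedType.Exports.

Local Open Scope classical_set_scope.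
Local Open Scope ring_scope.

Section semi_inner_product.
Context {R : realType} {T : Type}.
Implicit Types (u v w : T -> R) (S : set (T -> R))
  (B : (T -> R) -> (T -> R) -> R).

Definition lc (a : R) u v : T -> R := fun x => a * u x + v x.

Record semi_inner S B : Prop := SemiInner {
  semi_inner_ex : exists u, S u;
  semi_inner_lc : forall a u v, S u -> S v -> S (lc a u v);
  semi_innerC : forall u v, S u -> S v -> B u v = B v u;
  semi_inner_lcl : forall a u v w, S u -> S v -> S w ->
    B (lc a u v) w = a * B u w + B v w;
  semi_inner_ge0 : forall u, S u -> 0 <= B u u }.

Definition dist2 B u v := B (lc (-1) u v) (lc (-1) u v).

(* Cauchy sequences with a geometric rate of convergence are enough. *)
Definition complete_form S B := forall v : nat -> T -> R,
  (forall n, S (v n)) ->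
  (forall n m, (n <= m)%N -> dist2 B (v m) (v n) <= 4^-1 ^+ n) ->
  exists2 u, S u & exists C : R, forall n, dist2 B u (v n) <= C * 4^-1 ^+ n.

Lemma le0_geometric (x C : R) : (forall n, x <= C * 4^-1 ^+ n) -> x <= 0.
Proof.
move=> h; have h4 : `|4^-1 : R| < 1 by rewrite ger0_norm; lra.
have : (fun n => C * 4^-1 ^+ n) @ \oo --> C * 0.
  by apply: cvgMl_tmp; exact: cvg_expr.
rewrite mulr0 => hC; rewrite -(cvg_lim _ hC)//; apply: limr_ge.
  by apply/cvg_ex; exists 0.
exact: nearW.
Qed.

Section theory.
Variables (S : set (T -> R)) (B : (T -> R) -> (T -> R) -> R).
Hypothesis SB : semi_inner S B.

Lemma semi_inner_lcr a u v w : S u -> S v -> S w ->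
  B w (lc a u v) = a * B w u + B w v.
Proof.
move=> Su Sv Sw; rewrite (semi_innerC SB)//; last exact: (semi_inner_lc SB).
by rewrite (semi_inner_lcl SB)// (semi_innerC SB Su)// (semi_innerC SB Sv).
Qed.

Lemma semi_inner_lc2 a u v : S u -> S v ->
  B (lc a u v) (lc a u v) = a ^+ 2 * B u u + 2 * a * B u v + B v v.
Proof.
move=> Su Sv; rewrite (semi_inner_lcl SB)// ?semi_inner_lcr//; last first.
  exact: (semi_inner_lc SB).
by rewrite (semi_innerC SB Sv)//; ring.
Qed.

Lemma dist2E u v : S u -> S v -> dist2 B u v = B u u - 2 * B u v + B v v.
Proof. by move=> Su Sv; rewrite /dist2 semi_inner_lc2//; ring. Qed.

Lemma dist2_ge0 u v : S u -> S v -> 0 <= dist2 B u v.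
Proof. by move=> Su Sv; apply/(semi_inner_ge0 SB)/(semi_inner_lc SB). Qed.

Lemma discriminant_le (a b c : R) : 0 <= a ->
  (forall t, 0 <= t ^+ 2 * a + 2 * t * b + c) -> b ^+ 2 <= c * a.
Proof.
move=> a0 h; have [a1|a1] := eqVneq a 0.
  have [->|b0] := eqVneq b 0; first by rewrite a1 expr0n/= mulr0.
  have := h (- (c + 1) / (2 * b)); rewrite a1 mulr0 add0r.
  have -> : 2 * (- (c + 1) / (2 * b)) * b + c = -1 by field.
  by rewrite ler0N1.
have a2 : 0 < a by rewrite lt0r a1.
have := h (- b / a).
have -> : (- b / a) ^+ 2 * a + 2 * (- b / a) * b + c = (c * a - b ^+ 2) / a.
  by field.
by rewrite pmulr_lge0 ?invr_gt0// subr_ge0.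
Qed.

Lemma semi_inner_CS u v : S u -> S v -> B u v ^+ 2 <= B u u * B v v.
Proof.
move=> Su Sv; rewrite mulrC; apply: discriminant_le => [|t].
  exact: (semi_inner_ge0 SB).
by rewrite -semi_inner_lc2//; apply/(semi_inner_ge0 SB)/(semi_inner_lc SB).
Qed.

Lemma semi_inner_CS_sqrt u v : S u -> S v ->
  `|B u v| <= Num.sqrt (B u u) * Num.sqrt (B v v).
Proof.
move=> Su Sv; rewrite -sqrtrM ?(semi_inner_ge0 SB)// -sqrtr_sqr.
by rewrite ler_wsqrtr// semi_inner_CS.
Qed.

(* Riesz representation: u minimizes B v v - 2 F v. *)
Lemma semi_inner_Riesz (F : (T -> R) -> R) : complete_form S B ->
  (forall a u v, S u -> S v -> F (lc a u v) = a * F u + F v) ->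
  (exists C : R, forall v, S v -> `|F v| <= C * Num.sqrt (B v v)) ->
  exists2 u, S u & forall v, S v -> F v = B u v.
Proof.
move=> cSB linF [C FC].
pose J v := B v v - 2 * F v.
have J_ge v : S v -> - C ^+ 2 <= J v.
  move=> Sv; have := FC _ Sv; have := sqr_sqrtr (semi_inner_ge0 SB Sv).
  rewrite /J; set s := Num.sqrt _ => <- /ler_normlP[_ h].
  have := sqr_ge0 (s - C); nra.
pose E := [set J v | v in S].
have lbE : has_inf E.
  split; first by have [u Su] := semi_inner_ex SB; exists (J u), u.
  by exists (- C ^+ 2) => _ [v Sv <-]; exact: J_ge.
set m := inf E.
have m_le v : S v -> m <= J v.
  by move=> Sv; apply: ge_inf; [exact: lbE.2|exists v].
have e0 n : 0 < 4^-1 ^+ n / 4 :> R by rewrite divr_gt0 ?exprn_gt0.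
have /choice[v vP] n : exists v, S v /\ J v < m + 4^-1 ^+ n / 4.
  by have [_ [v Sv <-] ?] := inf_adherent (e0 n) lbE; exists v.
have Sv n : S (v n) by have [] := vP n.
have vC n k : (n <= k)%N -> dist2 B (v k) (v n) <= 4^-1 ^+ n.
  move=> nk.
  have Sd : S (lc (-1) (v k) (v n)) by exact: (semi_inner_lc SB).
  have := m_le _ (semi_inner_lc SB 2^-1 Sd (Sv k)).
  rewrite /J semi_inner_lc2// -/(dist2 B (v k) (v n)) linF// linF//.
  rewrite (semi_inner_lcl SB)// dist2E//.
  rewrite [B (v n) (v k)](semi_innerC SB)//.
  have [_] := vP n; have [_] := vP k; rewrite /J.
  have : 4^-1 ^+ k <= 4^-1 ^+ n :> R by apply: ler_wiXn2l => //; lra.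
  by move=> ? ? ?; lra.
have [u Su [D uD]] := cSB v Sv vC.
exists u => // w Sw; apply/eqP.
rewrite eq_sym -subr_eq0 -sqrf_eq0 eq_le sqr_ge0 andbT.
apply: (@le0_geometric _ ((2 * D + 1) * B w w)) => n.
have Bw := semi_inner_ge0 SB Sw.
have h1 : (B (v n) w - F w) ^+ 2 <= 4^-1 ^+ n / 4 * B w w.
  apply: discriminant_le => // t.
  have := m_le _ (semi_inner_lc SB t Sw (Sv n)).
  rewrite /J semi_inner_lc2// linF// (semi_innerC SB Sw)//.
  have [_] := vP n; rewrite /J; lra.
have h2 : (B u w - B (v n) w) ^+ 2 <= D * 4^-1 ^+ n * B w w.
  have -> : B u w - B (v n) w = - B (lc (-1) u (v n)) w.
    by rewrite (semi_inner_lcl SB)//; ring.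
  rewrite sqrrN; apply: le_trans (ler_wpM2r Bw (uD n)).
  exact: semi_inner_CS (semi_inner_lc SB (-1) Su (Sv n)) Sw.
have := sqr_ge0 ((B u w - B (v n) w) - (B (v n) w - F w)).
have := e0 n; nra.
Qed.

Lemma semi_inner_orthogonal (Q : set (T -> R)) : Q `<=` S ->
  let S' := [set v | S v /\ forall q, Q q -> B q v = 0] in
  semi_inner S' B /\ (complete_form S B -> complete_form S' B).
Proof.
move=> QS S'; split.
  split.
  - have [u Su] := semi_inner_ex SB; exists (lc (-1) u u).
    split=> [|q /QS Sq]; first exact: (semi_inner_lc SB).
    by rewrite semi_inner_lcr//; ring.
  - move=> a u v [Su uQ] [Sv vQ]; split; first exact: (semi_inner_lc SB).
    by move=> q Qq; rewrite semi_inner_lcr ?uQ ?vQ//; [ring|exact: QS].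
  - by move=> u v [Su _] [Sv _]; exact: (semi_innerC SB).
  - by move=> a u v w [Su _] [Sv _] [Sw _]; exact: (semi_inner_lcl SB).
  - by move=> u [Su _]; exact: (semi_inner_ge0 SB).
move=> cS v S'v vC.
have [u Su [D uD]] := cS v (fun n => (S'v n).1) vC.
exists u; last by exists D.
split=> // q Qq; have Sq := QS _ Qq.
apply/eqP; rewrite -sqrf_eq0 eq_le sqr_ge0 andbT.
apply: (@le0_geometric _ (D * B q q)) => n; have [Sv vQ] := S'v n.
have -> : B q u ^+ 2 = B (lc (-1) u (v n)) q ^+ 2.
  rewrite (semi_inner_lcl SB)// [B (v n) q](semi_innerC SB)// vQ//.
  by rewrite (semi_innerC SB Su)//; ring.
have := semi_inner_CS (semi_inner_lc SB (-1) Su Sv) Sq.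
move=> /le_trans; apply; rewrite mulrAC; apply: ler_wpM2r; last exact: uD.
exact: (semi_inner_ge0 SB).
Qed.

End theory.
End semi_inner_product.

Section square_integrable.
Context {d} {T : measurableType d} {R : realType}.
Variable mu : {finite_measure set T -> \bar R}.
Implicit Types f g h : T -> R.

Definition Lfun2s : set (T -> R) := [set f | f \in Lfun mu 2%:E].

Definition ipL2 f g := \int[mu]_x (f x * g x).

Lemma Lfun2P f : f \in Lfun mu 2%:E <->
  measurable_fun setT f /\ (\int[mu]_x (f x ^+ 2)%:E < +oo)%E.
Proof.
split=> [Lf|[mf fi]].
  split; first by move: Lf; rewrite inE => /andP[]; rewrite inE.
  exact/integrable_lty/Lfun2_integrable_sqr.
rewrite inE; apply/andP; split; rewrite inE//= /finite_norm unlock poweR_lty//.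
apply: le_lt_trans fi; rewrite le_eqVlt; apply/orP; left; apply/eqP.
by apply: eq_integral => x _; rewrite /= powR_mulrn// real_normK// num_real.
Qed.

Lemma Lfun2_measurable f : f \in Lfun mu 2%:E -> measurable_fun setT f.
Proof. by case/Lfun2P. Qed.

Lemma Lfun2_mul_integrable f g : f \in Lfun mu 2%:E -> g \in Lfun mu 2%:E ->
  mu.-integrable setT (EFin \o (fun x => f x * g x)).
Proof. by move=> Lf Lg; apply/Lfun1_integrable/Lfun2_mul_Lfun1. Qed.

Lemma Lfun2_bounded f (M : R) : measurable_fun setT f ->
  (forall x, `|f x| <= M) -> f \in Lfun mu 2%:E.
Proof.
move=> mf fM; apply/Lfun2P; split => //.
apply: (@le_lt_trans _ _ (\int[mu]_x (M ^+ 2)%:E)%E).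
  apply: ge0_le_integral => //.
  - by move=> x _; rewrite lee_fin sqr_ge0.
  - by apply/measurable_EFinP; exact: measurable_funX.
  - move=> x _; rewrite lee_fin -[leLHS]real_normK ?num_real//.
    by rewrite ler_sqr ?nnegrE// (le_trans _ (fM x)).
rewrite integral_cst//; apply: lte_mul_pinfty => //.
  by rewrite lee_fin sqr_ge0.
by rewrite ltey_eq fin_num_measure.
Qed.

Lemma Lfun2_lc a f g : f \in Lfun mu 2%:E -> g \in Lfun mu 2%:E ->
  lc a f g \in Lfun mu 2%:E.
Proof.
move=> Lf Lg.
have := @Lfun_submod_closed _ _ _ mu 2%:E (lee1n 2).
by move=> [_ h]; exact: (h a f g).
Qed.

Lemma Lfun2s_lc a f g : Lfun2s f -> Lfun2s g -> Lfun2s (lc a f g).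
Proof. exact: Lfun2_lc. Qed.

Lemma Lfun2s_cst c : Lfun2s (cst c). Proof. exact: Lfun_cst. Qed.

Lemma semi_inner_L2 : semi_inner Lfun2s ipL2.
Proof.
split.
- by exists (cst 0); exact: Lfun2s_cst.
- exact: Lfun2s_lc.
- by move=> u v _ _; apply: eq_Rintegral => x _; rewrite mulrC.
- move=> a u v w /= Lu Lv Lw; rewrite /ipL2.
  rewrite -RintegralZl//; last exact: Lfun2_mul_integrable.
  rewrite -RintegralD//; last 2 first.
  + exact: integrableZl (Lfun2_mul_integrable _ _).
  + exact: Lfun2_mul_integrable.
  by apply: eq_Rintegral => x _; rewrite /lc mulrDl mulrA.
- by move=> u _; apply: Rintegral_ge0 => x _; rewrite -expr2 sqr_ge0.
Qed.

Lemma Rintegral_sqr_ipL2 f : f \in Lfun mu 2%:E ->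
  (\int[mu]_x (f x ^+ 2)%:E)%E = (ipL2 f f)%:E.
Proof.
move=> Lf; rewrite /ipL2 /Rintegral fineK.
  by apply: eq_integral.
exact/integrable_fin_num/Lfun2_mul_integrable.
Qed.

(* As for the Riesz-Fischer theorem: \sum_n |f n.+1 - f n| is integrable, hence
   finite almost everywhere. *)
Lemma ae_cvg_geometric (f : nat -> T -> R) :
  (forall n, f n \in Lfun mu 2%:E) ->
  (forall n m, (n <= m)%N -> dist2 ipL2 (f m) (f n) <= 4^-1 ^+ n) ->
  {ae mu, forall x, cvg (f n x @[n --> \oo])}.
Proof.
move=> Lf fC; pose h n x : R := `|f n.+1 x - f n x|.
have mh n : measurable_fun setT (EFin \o h n).
  apply/measurable_EFinP; apply: measurableT_comp => //.
  by apply: measurable_funB; exact: Lfun2_measurable.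
have h0 n x : setT x -> (0 <= (h n x)%:E)%E by rewrite lee_fin normr_ge0.
have hint n : (\int[mu]_x (h n x)%:E <=
    ((1 + fine (mu setT)) * 2^-1 ^+ n)%:E)%E.
  (* AM-GM: [2 h <= 2 ^ n h ^ 2 + 2 ^- n] *)
  have e2 : 0 < 2^-1 ^+ n :> R by rewrite exprn_gt0.
  have Ld : lc (-1) (f n) (f n.+1) \in Lfun mu 2%:E by exact: Lfun2_lc.
  have md : measurable_fun [set: T]
      (EFin \o (fun x => lc (-1) (f n) (f n.+1) x ^+ 2)).
    by apply/measurable_EFinP/measurable_funX; exact: Lfun2_measurable Ld.
  apply: (@le_trans _ _ (\int[mu]_x ((2^-1 ^+ n)^-1%:E *
      (lc (-1) (f n) (f n.+1) x ^+ 2)%:E + (2^-1 ^+ n)%:E))%E).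
    apply: ge0_le_integral => //.
    - exact: h0.
    - exact: mh.
    - by apply: emeasurable_funD => //; exact: measurable_funeM.
    - move=> x _; rewrite -EFinM -EFinD lee_fin /h.
      set y := lc _ _ _ _; have -> : f n.+1 x - f n x = y.
        by rewrite /y /lc mulN1r addrC.
      rewrite -(ler_pM2l e2) mulrDr mulrA divff ?gt_eqF// mul1r.
      rewrite -[X in _ <= X + _]real_normK ?num_real//.
      have := sqr_ge0 (`|y| - 2^-1 ^+ n); have := normr_ge0 y; nra.
  rewrite ge0_integralD//; last 2 first.
    - by move=> x _; rewrite -EFinM lee_fin mulr_ge0 ?sqr_ge0// invr_ge0 ltW.
    - exact: measurable_funeM.
  rewrite ge0_integralZl ?lee_fin ?invr_ge0 ?(ltW e2)//; last first.
    by move=> x _; rewrite lee_fin sqr_ge0.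
  rewrite Rintegral_sqr_ipL2// integral_cst//.
  rewrite -[X in (_ + _ * X)%E]fineK ?fin_num_measure// -!EFinM -EFinD lee_fin.
  rewrite mulrDl mul1r [fine _ * _]mulrC lerD2r ler_pdivrMl// -expr2 exprAC.
  have -> : 2^-1 ^+ 2 = 4^-1 :> R by field.
  have := fC n n.+1 (leqnSn n); rewrite /dist2.
  suff -> : ipL2 (lc (-1) (f n.+1) (f n)) (lc (-1) (f n.+1) (f n)) =
    ipL2 (lc (-1) (f n) (f n.+1)) (lc (-1) (f n) (f n.+1)) by [].
  by apply: eq_Rintegral => x _; rewrite /lc; ring.
have : {ae mu, forall x, setT x ->
    (\sum_(0 <= n <oo) (h n x)%:E)%E \is a fin_num}.
  apply: integrable_ae => //; apply/integrableP; split.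
    apply: (@ge0_emeasurable_sum _ _ _ _ (fun n x => (h n x)%:E) xpredT).
      by move=> k x ? _; exact: h0.
    by move=> k _; exact: mh.
  rewrite (_ : (\int[mu]_x _)%E =
      (\int[mu]_x (\sum_(0 <= n <oo) (h n x)%:E))%E); last first.
    apply: eq_integral => x _; rewrite gee0_abs//.
    by apply: nneseries_ge0 => *; exact: h0.
  rewrite integral_nneseries//.
  apply: (@le_lt_trans _ _
    (\sum_(0 <= n <oo) ((1 + fine (mu setT)) * 2^-1 ^+ n)%:E)%E).
    by apply: lee_nneseries => // n _ _; apply: integral_ge0 => x _; exact: h0.
  have c0 : 0 <= 1 + fine (mu setT) by rewrite addr_ge0// fine_ge0.
  rewrite (@le_lt_trans _ _ ((1 + fine (mu setT)) * (1 - 2^-1)^-1)%:E) ?ltry//.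
  apply: lime_le.
    by apply: is_cvg_nneseries => n _ _; rewrite lee_fin mulr_ge0// exprn_ge0.
  apply: nearW => n; rewrite sumEFin lee_fin.
  apply: geometric_le_lim => //; rewrite ger0_norm; lra.
apply: filterS => x /(_ I) hx.
have cs : cvgn [normed series (fun n => f n.+1 x - f n x : R^o)].
  apply: nondecreasing_is_cvgn.
    apply/nondecreasing_seqP => n; rewrite /normed_series_of seriesSr lerDl.
    exact: normr_ge0.
  exists (fine (\sum_(0 <= n <oo) (h n x)%:E)%E) => _ [n _ <-].
  rewrite -lee_fin fineK// /series/= -sumEFin.
  by apply: (nneseries_lim_ge n) => k *; exact: h0.
have := @normed_cvg R R^o _ cs; rewrite (_ : series _ = fun n => f n x - f 0 x).
  move=> /(is_cvgD (is_cvg_cst (f 0%N x))).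
  by congr (cvgn _); apply/funext => n /=; rewrite fctE/= subrKC.
by apply/funext => n; rewrite /series/= telescope_sumr.
Qed.

End square_integrable.

Section integral_ae_eq.
Context {d} {T : measurableType d} {R : realType}.
Variable mu : {measure set T -> \bar R}.
Local Open Scope ereal_scope.
Import HBNNSimple.

Let ge0_ae_le_integralT (f g : T -> \bar R) : (forall x, 0 <= f x) ->
  (forall x, 0 <= g x) -> {ae mu, forall x, f x = g x} ->
  \int[mu]_x f x <= \int[mu]_x g x.
Proof.
move=> f0 g0 [N [mN N0 Nfg]]; rewrite !ge0_integralTE//.
apply: ge_ereal_sup => _ [h /= hf <-].
have mCN := measurableC mN.
apply: le_ereal_sup_tmp; exists (sintegral mu (proj_nnsfun h mCN)).
  exists (proj_nnsfun h mCN) => // x; rewrite /= mindicE.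
  have [/set_mem xN|_] := boolP (x \in ~` N); last by rewrite mulr0 g0.
  rewrite mulr1 (le_trans (hf x))// (_ : f x = g x)//.
  by apply: contrapT => fgx; apply: xN; exact: Nfg.
rewrite -!integralT_nnsfun le_eqVlt; apply/orP; left; apply/eqP.
apply: ge0_ae_eq_integral => //.
- exact/measurable_EFinP.
- exact/measurable_EFinP.
- by move=> x _; rewrite lee_fin.
- by move=> x _; rewrite lee_fin.
- exists N; split => // x /=; rewrite mindicE.
  apply: contra_notP => xN _; rewrite mem_set ?mulr1//.
Qed.

(* Unlike [ae_eq_integral], no measurability is required: [gderiv] has
   unspecified values where the limit does not exist. *)
Lemma ae_eq_integralT (f g : T -> \bar R) : {ae mu, forall x, f x = g x} ->
  \int[mu]_x f x = \int[mu]_x g x.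
Proof.
move=> fg.
have : ae_eq mu setT f g by apply: filterS fg => x ->.
move=> /ae_eq_funeposneg[fgp fgn].
rewrite integralE [RHS]integralE; congr (_ - _); apply/eqP; rewrite eq_le;
  apply/andP; split; apply: ge0_ae_le_integralT => //.
- by apply: filterS fgp => x; exact.
- by apply: filterS fgp => x /(_ I).
- by apply: filterS fgn => x; exact.
- by apply: filterS fgn => x /(_ I).
Qed.

End integral_ae_eq.

Section L2_complete.
Context {d} {T : measurableType d} {R : realType}.
Variable mu : {finite_measure set T -> \bar R}.
Implicit Types f g h : T -> R.

Lemma ae_eq_RintegralT f g : {ae mu, forall x, f x = g x} ->
  \int[mu]_x f x = \int[mu]_x g x.
Proof.
move=> fg; congr fine; apply: ae_eq_integralT.
by apply: filterS fg => x ->.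
Qed.

Lemma complete_form_L2 : complete_form (Lfun2s mu) (ipL2 mu).
Proof.
move=> f Lf fC; have mf n := Lfun2_measurable (Lf n).
pose u x := fine (limn_esup (fun n => (f n x)%:E)).
have mu_ : measurable_fun setT u.
  apply: (@measurableT_comp _ _ _ _ _ _ fine) => //.
  apply: (@measurable_fun_limn_esup _ _ _ _ (fun n x => (f n x)%:E)) => n.
  exact/measurable_EFinP.
have fu : {ae mu, forall x, f n x @[n --> \oo] --> u x}.
  apply: filterS (ae_cvg_geometric Lf fC) => x cf.
  have h : (f n x)%:E @[n --> \oo] --> (limn (f ^~ x))%:E.
    by apply: cvg_EFin; [exact: nearW|].
  by rewrite /u (cvg_limn_einf_sup h).2.
have le4 n : (\int[mu]_x (lc (-1) u (f n) x ^+ 2)%:E <= (4^-1 ^+ n)%:E)%E.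
  pose s m x := (lc (-1) (f m) (f n) x ^+ 2)%:E.
  have ms m : measurable_fun setT (s m).
    apply/measurable_EFinP/measurable_funX/measurable_funD => //.
    exact: measurable_funM.
  apply: (@le_trans _ _ (\int[mu]_x limn_einf (s^~ x))%E).
    rewrite le_eqVlt; apply/orP; left; apply/eqP; apply: ae_eq_integralT.
    apply: filterS fu => x fux; apply/esym.
    suff h : s^~ x @ \oo --> (lc (-1) u (f n) x ^+ 2)%:E.
      by rewrite (cvg_limn_einf_sup h).1.
    apply: cvg_EFin; first exact: nearW.
    have fux' : lc (-1) (f m) (f n) x @[m --> \oo] --> lc (-1) u (f n) x.
      by apply: cvgD; [exact: cvgMl_tmp|exact: cvg_cst].
    exact: (cvgM fux' fux').
  apply: le_trans (fatou mu measurableT ms _) _.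
    by move=> m x _; rewrite lee_fin sqr_ge0.
  rewrite limn_einf_lim; apply: lime_le; first exact: is_cvg_einfs.
  apply: nearW => m; apply: ge_ereal_inf => /=.
  exists (\int[mu]_x s (maxn m n) x)%E; last first.
    rewrite (Rintegral_sqr_ipL2 (Lfun2_lc (-1) (Lf (maxn m n)) (Lf n))).
    by rewrite lee_fin; apply: fC; exact: leq_maxr.
  by exists (maxn m n) => //=; exact: leq_maxl.
have Ld n : lc (-1) u (f n) \in Lfun mu 2%:E.
  apply/Lfun2P; split; last by rewrite (le_lt_trans (le4 n))// ltry.
  by apply: measurable_funD => //; exact: measurable_funM.
have Lu : u \in Lfun mu 2%:E.
  rewrite (_ : u = lc (-1) (lc (-1) u (f 0%N)) (f 0%N)).
    exact: Lfun2_lc (Ld 0%N) (Lf 0%N).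
  by apply/funext => x; rewrite /lc; ring.
exists u => //; exists 1 => n; rewrite mul1r.
by rewrite -lee_fin /dist2 -Rintegral_sqr_ipL2.
Qed.

End L2_complete.

Section projection.
Context {R : realType} {T : Type}.
Variables (S : set (T -> R)) (B : (T -> R) -> (T -> R) -> R).
Hypotheses (SB : semi_inner S B) (cS : complete_form S B).

Lemma semi_inner_projection (Q : set (T -> R)) (g : T -> R) : Q `<=` S -> S g ->
  let S' := [set v | S v /\ forall q, Q q -> B q v = 0] in
  exists2 u, S' u & forall k, S' k -> B g k = B u k.
Proof.
move=> QS Sg S'; have [S'B /(_ cS) cS'] := semi_inner_orthogonal SB QS.
apply: (semi_inner_Riesz S'B cS').
  by move=> a u v [Su _] [Sv _]; rewrite (semi_inner_lcr SB).
exists (Num.sqrt (B g g)) => v [Sv _]; exact: (semi_inner_CS_sqrt SB).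
Qed.

Lemma semi_inner_null u v : S u -> S v -> B u u = 0 -> B u v = 0.
Proof.
move=> Su Sv u0; apply/eqP; rewrite -sqrf_eq0 eq_le sqr_ge0 andbT.
by apply: le_trans (semi_inner_CS SB Su Sv) _; rewrite u0 mul0r.
Qed.

Lemma semi_inner_cvg u v q (C : R) n : S u -> S v -> S q ->
  dist2 B u v <= C * 4^-1 ^+ n ->
  (B q u - B q v) ^+ 2 <= B q q * C * 4^-1 ^+ n.
Proof.
move=> Su Sv Sq uv; have Sd := semi_inner_lc SB (-1) Su Sv.
have -> : B q u - B q v = - B q (lc (-1) u v).
  by rewrite (semi_inner_lcr SB)//; ring.
rewrite sqrrN; apply: le_trans (semi_inner_CS SB Sq Sd) _.
by rewrite -mulrA; apply: ler_wpM2l uv; exact: (semi_inner_ge0 SB).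
Qed.

End projection.

(* The notions of Defs.v for arbitrary finite measures [mu0] and [mu i] in place
   of [dx] and [dxW W i], with [D i g G] in place of [weak_deriv W A i g G]. *)
Section Sobolev.
Context {disp} {T : measurableType disp} {R : realType} {d : nat}.
Variables (mu0 : {finite_measure set T -> \bar R})
  (mu : 'I_d -> {finite_measure set T -> \bar R})
  (D : 'I_d -> (T -> R) -> (T -> R) -> Prop).
Implicit Types (f g G v w p q : T -> R) (F : (T -> R) -> R) (i : 'I_d).

Definition sobolev : set (T -> R) :=
  [set g | Lfun2s mu0 g /\ forall i, exists G, D i g G].

Definition grad i g : T -> R :=
  get [set G | D i g G /\
    forall G', D i g G' ->
      \int[mu i]_x (G x * G x) <= \int[mu i]_x (G' x * G' x)].

Definition ipS g v : R :=
  \int[mu0]_x (g x * v x) + \sum_(i < d) \int[mu i]_x (grad i g x * grad i v x).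

Definition normS g : R := Num.sqrt (ipS g g).

Definition dualS F :=
  (forall (a : R) v w, sobolev v -> sobolev w ->
     F (fun x => a * v x + w x) = a * F v + F w) /\
  (exists C : R, forall v, sobolev v -> `|F v| <= C * normS v).

Definition norm_dual F : R :=
  sup [set `|F v| | v in [set v | sobolev v /\ normS v <= 1]].

Definition reprS F f0 (f : 'I_d -> T -> R) :=
  [/\ Lfun2s mu0 f0,
    forall k, Lfun2s (mu k) (f k) /\ \int[mu k]_x f k x = 0 &
    forall v, sobolev v ->
      F v = \int[mu0]_x (f0 x * v x) +
            \sum_(i < d) \int[mu i]_x (f i x * grad i v x)].

Definition repr_normS f0 (f : 'I_d -> T -> R) : R :=
  Num.sqrt (\int[mu0]_x `|f0 x| ^+ 2 +
            \sum_(i < d) \int[mu i]_x `|f i x| ^+ 2).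

(* [TP i p q] stands for p = \partial_{x_i} \partial_{W_i} f and
   q = \partial_{W_i} f almost everywhere, for some test function f. *)
Variable TP : 'I_d -> (T -> R) -> (T -> R) -> Prop.
Hypothesis TP_L2 : forall i p q, TP i p q -> Lfun2s mu0 p /\ Lfun2s (mu i) q.

Local Notation B0 := (ipL2 mu0).
Local Notation Bi i := (ipL2 (mu i)).

Hypothesis DP : forall i g G, D i g G <->
  [/\ Lfun2s (mu i) G, Bi i (cst 1) G = 0 &
      forall p q, TP i p q -> B0 p g = - Bi i q G].

Let SB0 := semi_inner_L2 mu0.
Let SBi i := semi_inner_L2 (mu i).
Let CB0 : complete_form (Lfun2s mu0) B0. Proof. exact: complete_form_L2. Qed.
Let CBi i : complete_form (Lfun2s (mu i)) (Bi i).
Proof. exact: complete_form_L2. Qed.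

Let sobolev_L2 g : sobolev g -> Lfun2s mu0 g. Proof. by case. Qed.

Let Q i := [set q | q = cst 1 \/ exists p, TP i p q].
(* [K i] consists of the weak i-th derivatives of 0. *)
Let K i := [set G | Lfun2s (mu i) G /\ forall q, Q i q -> Bi i q G = 0].

Let L1 i : Lfun2s (mu i) (cst 1). Proof. exact: Lfun2s_cst. Qed.

Let QL i : Q i `<=` Lfun2s (mu i).
Proof. by move=> q [->|[p /TP_L2[]]]//. Qed.

Let KL i : K i `<=` Lfun2s (mu i).
Proof. by move=> q []. Qed.

Lemma D_lc i a g g' G G' : Lfun2s mu0 g -> Lfun2s mu0 g' ->
  D i g G -> D i g' G' -> D i (lc a g g') (lc a G G').
Proof.
move=> Lg Lg' /DP[LG G0 hG] /DP[LG' G0' hG'].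
have L1i := L1 i; apply/DP; split.
- exact: Lfun2s_lc.
- by rewrite (semi_inner_lcr (SBi i))// G0 G0'; ring.
- move=> p q pq; have [Lp Lq] := TP_L2 pq.
  rewrite (semi_inner_lcr SB0)// (semi_inner_lcr (SBi i))//.
  by rewrite (hG p q)// (hG' p q)//; ring.
Qed.

Let D_subK i g G G' :
  D i g G -> D i g G' -> K i (lc (-1) G G').
Proof.
move=> /DP[LG G0 hG] /DP[LG' G0' hG'].
split=> [|q]; first exact: Lfun2s_lc.
have L1i := L1 i; case=> [->|[p pq]].
  by rewrite (semi_inner_lcr (SBi i))// G0 G0'; ring.
have [_ Lq] := TP_L2 pq; rewrite (semi_inner_lcr (SBi i))//.
by apply: oppr_inj; have := hG _ _ pq; rewrite (hG' _ _ pq); lra.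
Qed.

Lemma gradP i g : sobolev g -> D i g (grad i g) /\
  forall k, K i k -> Bi i (grad i g) k = 0.
Proof.
move=> Hg; have Lg := sobolev_L2 Hg; have [_ /(_ i)[G0 wG0]] := Hg.
have LG0 : Lfun2s (mu i) G0 by case/DP: wG0.
have [u Ku uP] := semi_inner_projection (SBi i) (@CBi i)
  (@QL i) LG0.
have Lu : Lfun2s (mu i) u by exact: Ku.1.
pose G := lc (-1) u G0.
have LG : Lfun2s (mu i) G by exact: Lfun2s_lc.
have Gorth k : K i k -> Bi i G k = 0.
  move=> Kk; have Lk := KL Kk.
  by rewrite (semi_inner_lcl (SBi i))// uP//; ring.
have L1i := L1 i; have wG : D i g G.
  have /DP[_ G00 hG0] := wG0; apply/DP; split => //.
    by rewrite (semi_inner_lcr (SBi i))// G00 Ku.2; [ring|left].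
  move=> p q pq; have [_ Lq] := TP_L2 pq.
  rewrite (semi_inner_lcr (SBi i))// (hG0 _ _ pq) Ku.2; last by right; exists p.
  by ring.
have GE G' : D i g G' ->
    Bi i G' G' = Bi i G G + dist2 (Bi i) G' G.
  move=> wG'; have Kd := D_subK wG' wG.
  have LG' : Lfun2s (mu i) G' by case/DP: wG'.
  have := Gorth _ Kd; rewrite (semi_inner_lcr (SBi i))// (dist2E (SBi i))//.
  by rewrite (semi_innerC (SBi i) LG)//; lra.
have [wH Hmin] : [set G | D i g G /\
    forall G', D i g G' ->
      \int[mu i]_x (G x * G x) <= \int[mu i]_x (G' x * G' x)]
    (grad i g).
  apply: getPex; exists G; split => // G' wG'.
  rewrite -/(Bi i G' G') -/(Bi i G G) (GE _ wG') lerDl.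
  by apply: (dist2_ge0 (SBi i)) => //; case/DP: wG'.
split => // k Kk; set H := grad i g in wH Hmin *.
have LH : Lfun2s (mu i) H by case/DP: wH.
have Ld : Lfun2s (mu i) (lc (-1) H G) by exact: Lfun2s_lc.
have d0 : dist2 (Bi i) H G = 0.
  apply/eqP; rewrite eq_le (dist2_ge0 (SBi i))// andbT.
  by have := Hmin _ wG; rewrite -/(Bi i H H) -/(Bi i G G) (GE _ wH) gerDl.
have := semi_inner_null (SBi i) Ld (KL Kk) d0.
by rewrite (semi_inner_lcl (SBi i)) ?Gorth//; [lra|exact: KL].
Qed.

Lemma grad_weak i g : sobolev g -> D i g (grad i g).
Proof. by move=> /(gradP i)[]. Qed.

Lemma Lfun_grad i g : sobolev g -> Lfun2s (mu i) (grad i g).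
Proof. by move=> /(grad_weak i)/DP[]. Qed.

Lemma grad_ip i g G h : sobolev g -> D i g G ->
  (forall k, K i k -> Bi i G k = 0) -> Lfun2s (mu i) h ->
  Bi i (grad i g) h = Bi i G h.
Proof.
move=> Hg wG Gorth Lh; have [wH Horth] := gradP i Hg.
have LH := Lfun_grad i Hg.
have LG : Lfun2s (mu i) G by case/DP: wG.
have Kd := D_subK wH wG.
have := semi_inner_null (SBi i) (KL Kd) Lh.
rewrite !(semi_inner_lcl (SBi i))//; last exact: KL.
rewrite Horth// Gorth// => /(_ ltac:(ring)); lra.
Qed.

Lemma sobolev_lc a v w : sobolev v -> sobolev w -> sobolev (lc a v w).
Proof.
move=> Hv Hw; split; first by apply: Lfun2s_lc; exact: sobolev_L2.
move=> i; exists (lc a (grad i v) (grad i w)).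
by apply: D_lc; [exact: sobolev_L2|exact: sobolev_L2|exact: grad_weak..].
Qed.

Lemma grad_lc i a v w h : sobolev v -> sobolev w ->
  Lfun2s (mu i) h -> Bi i (grad i (lc a v w)) h =
  a * Bi i (grad i v) h + Bi i (grad i w) h.
Proof.
move=> Hv Hw Lh; have [wv ov] := gradP i Hv; have [ww ow] := gradP i Hw.
have Lv := Lfun_grad i Hv; have Lw := Lfun_grad i Hw.
rewrite -(semi_inner_lcl (SBi i))//.
apply: grad_ip => //; first exact: sobolev_lc.
  by apply: D_lc => //; exact: sobolev_L2.
move=> k Kk; rewrite (semi_inner_lcl (SBi i))//; last exact: KL.
by rewrite ov// ow//; ring.
Qed.

Lemma sobolev0 : sobolev (cst 0).
Proof.
split=> [|i]; first by exact: Lfun2s_cst.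
exists (cst 0); apply/DP; split; first exact: Lfun2s_cst.
  rewrite /ipL2; under eq_Rintegral do rewrite mulr0.
  by rewrite Rintegral_cst// mul0r.
move=> p q _; rewrite /ipL2.
under eq_Rintegral do rewrite mulr0.
under [in RHS]eq_Rintegral do rewrite mulr0.
by rewrite !Rintegral_cst// !mul0r oppr0.
Qed.

Lemma semi_inner_sobolev : semi_inner (sobolev) (ipS).
Proof.
split.
- by exists (cst 0); exact: sobolev0.
- by move=> a u v; exact: sobolev_lc.
- move=> u v Hu Hv; rewrite /ipS -/(B0 u v) -/(B0 v u).
  rewrite (semi_innerC SB0); [congr (_ + _)|exact: sobolev_L2..].
  by apply: eq_bigr => i _; apply: (semi_innerC (SBi i)); exact: Lfun_grad.
- move=> a u v w Hu Hv Hw; rewrite /ipS mulrDr mulr_sumr addrACA -big_split/=.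
  congr (_ + _).
    by apply: (semi_inner_lcl SB0); exact: sobolev_L2.
  by apply: eq_bigr => i _; apply: grad_lc => //; exact: Lfun_grad.
- move=> u Hu; apply: addr_ge0.
    exact: (semi_inner_ge0 SB0 (sobolev_L2 Hu)).
  apply: sumr_ge0 => i _.
  by apply: (semi_inner_ge0 (SBi i)); exact: Lfun_grad.
Qed.

Lemma ipSE u v : ipS u v =
  B0 u v + \sum_(i < d) Bi i (grad i u) (grad i v).
Proof. by []. Qed.

Lemma dist2_ipS u v : sobolev u -> sobolev v ->
  dist2 (ipS) u v =
  dist2 B0 u v + \sum_(i < d) dist2 (Bi i) (grad i u) (grad i v).
Proof.
move=> Hu Hv; have Lu := sobolev_L2 Hu; have Lv := sobolev_L2 Hv.
rewrite (dist2E semi_inner_sobolev)// (dist2E SB0)//.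
have -> : \sum_(i < d) dist2 (Bi i) (grad i u) (grad i v) =
    \sum_(i < d) (Bi i (grad i u) (grad i u) -
      2 * Bi i (grad i u) (grad i v) +
      Bi i (grad i v) (grad i v)).
  apply: eq_bigr => i _; apply: (dist2E (SBi i)); exact: Lfun_grad.
rewrite big_split/= sumrB -mulr_sumr !ipSE.
set s1 := \sum_(i < d) _; set s2 := \sum_(i < d) _; set s3 := \sum_(i < d) _.
move: (B0 u u) (B0 u v) (B0 v v) s1 s2 s3 => *; ring.
Qed.

Lemma complete_form_sobolev : complete_form (sobolev) (ipS).
Proof.
move=> v Hv vC.
have Lv n : Lfun2s mu0 (v n) by exact: sobolev_L2.
have Lwv n i := Lfun_grad i (Hv n).
have dB0 n m : 0 <= dist2 B0 (v m) (v n).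
  exact: (dist2_ge0 SB0 (Lv m) (Lv n)).
have dBi i n m : 0 <= dist2 (Bi i) (grad i (v m)) (grad i (v n)).
  exact: (dist2_ge0 (SBi i) (Lwv m i) (Lwv n i)).
have [u Lu [C0 uC]] : exists2 u, Lfun2s mu0 u &
    exists C, forall n, dist2 B0 u (v n) <= C * 4^-1 ^+ n.
  apply: CB0 => // n m nm.
  have := vC n m nm; rewrite dist2_ipS//; apply: le_trans.
  by rewrite lerDl; exact: sumr_ge0.
pose Q' i := [set q | q = cst 1 \/ K i q].
have QL' i : Q' i `<=` Lfun2s (mu i).
  by move=> q [->|/KL]//=.
have /choice[G GP] i : exists G, [/\ Lfun2s (mu i) G,
    forall q, Q' i q -> Bi i q G = 0 &
    exists C, forall n, dist2 (Bi i) G (grad i (v n)) <= C * 4^-1 ^+ n].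
  have [_ /(_ (@CBi i)) cQ] := semi_inner_orthogonal (SBi i) (@QL' i).
  have [||G [LG QG] GC] := cQ (fun n => grad i (v n)); last by exists G.
    move=> n; split => // q [->|Kq].
      by have /DP[] := grad_weak i (Hv n).
    have [_ h] := gradP i (Hv n).
    by rewrite (semi_innerC (SBi i)) ?h//; exact: KL.
  move=> n m nm; have := vC n m nm; rewrite dist2_ipS//; apply: le_trans.
  rewrite (bigD1 i)//= addrCA lerDl addr_ge0//; exact: sumr_ge0.
have wG i : D i u (G i).
  have [LG QG [C GC]] := GP i; apply/DP; split => //; first by apply: QG; left.
  move=> p q pq; have [Lp Lq] := TP_L2 pq.
  apply/eqP; rewrite -addr_eq0 -sqrf_eq0 eq_le sqr_ge0 andbT.
  apply: (@le0_geometric _ _ (2 * (B0 p p * C0) + 2 * (Bi i q q * C))) => n.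
  have /DP[_ _ /(_ _ _ pq) h] := grad_weak i (Hv n).
  have := semi_inner_cvg SB0 Lu (Lv n) Lp (uC n).
  have := semi_inner_cvg (SBi i) LG (Lwv n i) Lq (GC n).
  rewrite h; set e := 4^-1 ^+ n; set x := B0 p u.
  set y := Bi i q (grad i (v n)).
  set z := Bi i q (G i); have := sqr_ge0 ((x - - y) - (z - y)); nra.
have Hu : sobolev u by split; [|move=> i; exists (G i)].
exists u => //.
have /choice[C CP] i : exists C, forall n,
  dist2 (Bi i) (G i) (grad i (v n)) <= C * 4^-1 ^+ n by have [] := GP i.
exists (C0 + \sum_(i < d) C i) => n; rewrite dist2_ipS// mulrDl mulr_suml.
apply: lerD => //; apply: ler_sum => i _; apply: le_trans (CP i n).
have [LG QG _] := GP i; have LH := Lfun_grad i Hu.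
have GK k : K i k -> Bi i (G i) k = 0.
  by move=> Kk; rewrite (semi_innerC (SBi i)) ?QG//; [right|exact: KL].
rewrite !(dist2E (SBi i))//.
rewrite (grad_ip Hu (wG i) GK)// (semi_innerC (SBi i) LG LH).
by rewrite (grad_ip Hu (wG i) GK)// (grad_ip Hu (wG i) GK).
Qed.

Lemma reprS_le F f0 (f : 'I_d -> T -> R) : reprS F f0 f ->
  forall v, sobolev v -> `|F v| <= repr_normS f0 f * normS v.
Proof.
move=> [Lf0 Lf FE] v Hv; have Lv := sobolev_L2 Hv.
have Lg i := Lfun_grad i Hv; have Lfi i := (Lf i).1.
have sE : repr_normS f0 f = Num.sqrt (B0 f0 f0 + \sum_(i < d) Bi i (f i) (f i)).
  congr (Num.sqrt (_ + _)).
    by apply: eq_Rintegral => x _; rewrite real_normK ?num_real.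
  apply: eq_bigr => i _.
  by apply: eq_Rintegral => x _; rewrite real_normK ?num_real.
have s0 : 0 <= B0 f0 f0 + \sum_(i < d) Bi i (f i) (f i).
  apply: addr_ge0; first exact: (semi_inner_ge0 SB0).
  by apply: sumr_ge0 => i _; exact: (semi_inner_ge0 (SBi i)).
rewrite FE// sE /normS -sqrtrM// -sqrtr_sqr ler_wsqrtr// [leRHS]mulrC.
apply: discriminant_le => // t.
have : 0 <= B0 (lc t f0 v) (lc t f0 v) +
  \sum_(i < d) Bi i (lc t (f i) (grad i v)) (lc t (f i) (grad i v)).
  apply: addr_ge0; first by apply: (semi_inner_ge0 SB0); exact: Lfun2s_lc.
  by apply: sumr_ge0 => i _; apply: (semi_inner_ge0 (SBi i)); exact: Lfun2s_lc.
rewrite (semi_inner_lc2 SB0)//.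
rewrite [X in 0 <= _ + X -> _](eq_bigr _ (fun i _ =>
  semi_inner_lc2 (SBi i) t (Lfi i) (Lg i))).
rewrite 2!big_split/= -!mulr_sumr ipSE.
rewrite -/(B0 f0 v).
have -> : \sum_(i < d) \int[mu i]_x (f i x * grad i v x) =
  \sum_(i < d) Bi i (f i) (grad i v) by [].
set s1 := \sum_(i < d) _; set s2 := \sum_(i < d) _; set s3 := \sum_(i < d) _.
by move: (B0 f0 f0) (B0 f0 v) (B0 v v) s1 s2 s3 => *; lra.
Qed.

Lemma reprS_dual F f0 (f : 'I_d -> T -> R) : reprS F f0 f -> dualS F.
Proof.
move=> rF; split; last by exists (repr_normS f0 f); exact: reprS_le.
have [Lf0 Lf FE] := rF; move=> a v w Hv Hw.
rewrite (FE _ (sobolev_lc a Hv Hw)) !FE// mulrDr mulr_sumr addrACA -big_split/=.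
congr (_ + _).
  by apply: (semi_inner_lcr SB0) => //; exact: sobolev_L2.
apply: eq_bigr => i _; have Lfi := (Lf i).1.
have LH u : sobolev u ->
    \int[mu i]_x (f i x * grad i u x) = Bi i (grad i u) (f i).
  by move=> Hu; rewrite (semi_innerC (SBi i) _ Lfi)//; exact: Lfun_grad.
by rewrite !LH ?grad_lc//; exact: sobolev_lc.
Qed.

Lemma repr_norm_grad u : repr_normS u (fun i => grad i u) = normS u.
Proof.
rewrite /repr_normS /normS /ipS; congr (Num.sqrt (_ + _)).
  by apply: eq_Rintegral => x _; rewrite real_normK ?num_real.
apply: eq_bigr => i _.
by apply: eq_Rintegral => x _; rewrite real_normK ?num_real.
Qed.

Lemma dual_reprS F : dualS F -> exists2 u, sobolev u &
  reprS F u (fun i => grad i u).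
Proof.
move=> [linF bF].
have [u Hu Fu] :=
  semi_inner_Riesz semi_inner_sobolev complete_form_sobolev linF bF.
exists u => //; split; [by exact: sobolev_L2| |exact: Fu].
move=> k; have /DP[Lk k0 _] := grad_weak k Hu; split => //; rewrite -[RHS]k0.
by apply: eq_Rintegral => x _; rewrite mul1r.
Qed.

Lemma norm_dual_Riesz F u : sobolev u ->
  reprS F u (fun i => grad i u) ->
  norm_dual F = normS u.
Proof.
move=> Hu rF; have [_ _ FE] := rF.
have SH := semi_inner_sobolev.
have n0 v : 0 <= normS v by exact: sqrtr_ge0.
have nle := reprS_le rF; rewrite repr_norm_grad in nle.
have ub : ubound [set `|F v| | v in [set v | sobolev v /\ normS v <= 1]]
    (normS u).
  move=> _ [v [Hv v1] <-]; apply: le_trans (nle _ Hv) _.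
  by rewrite -[leRHS]mulr1 ler_wpM2l.
have has0 : [set `|F v| | v in [set v | sobolev v /\ normS v <= 1]] !=set0.
  exists `|F (cst 0)|, (cst 0) => //; split; first exact: sobolev0.
  have z : cst 0 = lc (-1) u u by apply/funext => x; rewrite /lc/=; ring.
  rewrite /normS z; have := dist2E SH Hu Hu; rewrite /dist2 => ->.
  by rewrite (_ : _ + _ = 0) ?sqrtr0//; ring.
apply/eqP; rewrite eq_le; apply/andP; split; first exact: ge_sup.
have Fu : F u = normS u ^+ 2.
  by rewrite FE// /normS sqr_sqrtr//; exact: (semi_inner_ge0 SH).
have [n1|n1] := eqVneq (normS u) 0.
  have [_ [v vP _]] := has0.
  rewrite n1; apply: le_trans (normr_ge0 (F v)) _.
  by apply: ub_le_sup; [exists (normS u)|exists v].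
have {}n1 : 0 < normS u by rewrite lt0r n1 n0.
set c := (normS u)^-1.
have Hc : sobolev (lc (c - 1) u u) by exact: sobolev_lc.
have Fc : F (lc (c - 1) u u) = normS u.
  have [linF _] := reprS_dual rF; rewrite (linF (c - 1) u u Hu Hu) Fu /c; field.
  by rewrite gt_eqF.
rewrite -[leLHS](ger0_norm (n0 u)) -{1}Fc.
apply: ub_le_sup; first by exists (normS u).
exists (lc (c - 1) u u) => //; split => //.
rewrite /normS (semi_inner_lc2 SH)//.
have -> : (c - 1) ^+ 2 * ipS u u + 2 * (c - 1) * ipS u u + ipS u u =
  c ^+ 2 * ipS u u by ring.
rewrite -[ipS u u]sqr_sqrtr; last exact: (semi_inner_ge0 SH).
by rewrite -/(normS u) /c -exprMn mulVf ?expr1n ?sqrtr1// gt_eqF.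
Qed.

Lemma dualS_repr F :
  (dualS F <-> exists f0 (f : 'I_d -> T -> R), reprS F f0 f) /\
  (dualS F ->
    norm_dual F = inf [set r | exists f0 (f : 'I_d -> T -> R),
      reprS F f0 f /\ r = repr_normS f0 f]).
Proof.
split.
  split=> [/dual_reprS[u _ rF]|[f0 [f]]]; last exact: reprS_dual.
  by exists u, (fun i => grad i u).
move=> /dual_reprS[u Hu rF]; rewrite (norm_dual_Riesz Hu rF).
set E := [set r | _].
have Eu : E (normS u) by exists u, (fun i => grad i u); rewrite repr_norm_grad.
have lE : lbound E (normS u).
  move=> _ [f0 [f [rf ->]]]; have := reprS_le rf Hu.
  have [_ _ ->] := rF => //; rewrite -/(ipS u u).
  have i0 : 0 <= ipS u u by exact: (semi_inner_ge0 semi_inner_sobolev).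
  rewrite ger0_norm// -[X in X <= _]sqr_sqrtr// -/(normS u) expr2.
  have [->|n0] := eqVneq (normS u) 0; first by rewrite sqrtr_ge0.
  by rewrite ler_pM2r// lt0r n0 sqrtr_ge0.
apply/eqP; rewrite eq_le; apply/andP; split.
  by apply: lb_le_inf => //; exists (normS u).
by apply: ge_inf => //; exists (normS u).
Qed.

End Sobolev.

Section torus_measure_integral.
Context {R : realType}.
Implicit Types (V W : cumulative R R) (f ff : R -> R).
Local Notation mu := (@lebesgue_measure R).

Lemma torus_measure_ae V : {ae torus_measure V, forall x, `[0, 1[%classic x}.
Proof.
exists (~` `[0, 1[%classic); split => //.
  by apply: measurableC; exact: measurable_itv.
by rewrite /torus_measure /mrestr/= setICl.
Qed.

Lemma integral_torus_measure V (f : R -> \bar R) :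
  (\int[torus_measure V]_x f x =
   \int[lebesgue_stieltjes_measure V]_(x in `[0%R, 1%R[) f x)%E.
Proof.
rewrite [RHS](@eq_measure_integral _ _ _ _ (torus_measure V)); last first.
  by move=> A mA A01; rewrite /= /torus_measure /mrestr setIidl.
rewrite integral_mkcond [RHS]integral_mkcond; apply: ae_eq_integralT.
have := torus_measure_ae V.
apply: filterS; first exact: (ae_filter_ringOfSetsType (torus_measure V)).
move=> x xI.
by rewrite !patchE in_setT mem_set.
Qed.

Lemma Rintegral_torus_dx f :
  \int[torus_dx R]_x f x = \int[mu]_(x in `[0, 1[) f x.
Proof. by rewrite /Rintegral integral_torus_measure. Qed.

Lemma integrable_torus_dx ff : ff \in Lfun (torus_dx R) 2%:E ->
  mu.-integrable `[0, 1] (EFin \o ff).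
Proof.
move=> Lff; have mff := Lfun2_measurable Lff.
have : (torus_dx R).-integrable setT (EFin \o ff).
  apply/Lfun1_integrable; apply: Lfun_subset12 Lff.
  exact: fin_num_measure.
move=> /integrableP[_ iff]; apply/integrableP; split.
  by apply/measurable_EFinP; exact: measurable_funTS.
rewrite -integral_itv_bndo_bndc; last first.
  apply: measurableT_comp => //; apply/measurable_EFinP.
  exact: measurable_funTS.
by rewrite integral_torus_measure in iff.
Qed.

Lemma ae_torus_dx (P : R -> Prop) :
  {ae mu, forall x, P x} -> {ae torus_dx R, forall x, P x}.
Proof.
move=> [N [mN N0 PN]]; exists N; split => //.
apply/eqP; rewrite -measure_le0 -N0 /= /torus_measure /mrestr.
by apply: le_measure; rewrite ?inE//; apply: measurableI => //;
  exact: measurable_itv.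
Qed.

Lemma lebesgue_stieltjes_itvoc V (u v : R) : u <= v ->
  lebesgue_stieltjes_measure V `]u, v] = (V v - V u)%:E.
Proof.
move=> uv; rewrite /lebesgue_stieltjes_measure /measure_extension.
by rewrite measurable_mu_extE/= ?wlength_itv_bnd//; exact: is_ocitv.
Qed.

End torus_measure_integral.

Definition torus_proj {R : realType} (x : R) : R := x - (Num.floor x)%:~R.

Lemma torus_projE {R : realType} (x : R) m :
  m%:~R <= x < (m + 1)%:~R -> torus_proj x = x - m%:~R.
Proof. by move=> /floor_def fx; rewrite /torus_proj fx. Qed.

Lemma torus_proj_id {R : realType} (x : R) : 0 <= x < 1 -> torus_proj x = x.
Proof. by move=> x01; rewrite (@torus_projE _ _ 0)// subr0. Qed.

Lemma torus_proj_itv {R : realType} (x : R) : torus_proj x \in `[0, 1[.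
Proof.
have := floor_itv x; rewrite in_itv/= /torus_proj intrD => /andP[h1 h2].
by rewrite subr_ge0 h1 ltrBlDl.
Qed.

Section LW_derivatives.
Context {R : realType}.
Local Notation mu := (@lebesgue_measure R).
Variables (W : cumulative R R) (ff : R -> R) (a b : R).
Hypotheses (Wsp : strict_periodic_increments W)
  (iff : mu.-integrable `[0, 1] (EFin \o ff))
  (ff0 : \int[mu]_(z in `[0, 1]) ff z = 0).
Local Notation LS := (lebesgue_stieltjes_measure W).

Let psi y := b + \int[mu]_(z in `[0, y]) ff z.
Let P x := a + b * W x + \int[LS]_(y in `]0, x]) \int[mu]_(z in `[0, y]) ff z.

Hypothesis P01 : \int[LS]_(y in `]0, 1]) psi y = 0.

Lemma Wderiv_continuous : {within `[0, 1], continuous psi}.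
Proof.
move=> x; apply: cvgD; first exact: cvg_cst.
exact: (parameterized_integral_continuous ler01 iff).
Qed.

Lemma Wderiv_measurable : measurable_fun `[0%R : R, 1%R] psi.
Proof.
apply: subspace_continuous_measurable_fun; first exact: measurable_itv.
exact: Wderiv_continuous.
Qed.

Lemma Wderiv_at0 : psi 0 = b.
Proof. by rewrite /psi set_itv1 Rintegral_set1 addr0. Qed.

Lemma Wderiv_at1 : psi 1 = b.
Proof. by rewrite /psi ff0 addr0. Qed.

Lemma Wderiv_bounded : exists M, forall x, x \in `[0, 1] -> `|psi x| <= M.
Proof.
have /compact_bounded[M [_ MP]] :=
  continuous_compact Wderiv_continuous (@segment_compact R 0 1).
exists (M + 1) => x x01; apply: MP; first by rewrite ltrDl.
by exists x.
Qed.

Lemma Wderiv_integrable u v : 0 <= u -> v <= 1 ->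
  LS.-integrable `]u, v] (EFin \o psi).
Proof.
move=> u0 v1; have uv01 : `]u, v]%classic `<=` `[0, 1]%classic.
  move=> x /=; rewrite !in_itv/= => /andP[ux xv].
  by rewrite (le_trans xv v1) (le_trans u0 (ltW ux)).
have [uv|vu] := leP u v; last first.
  by rewrite set_itv_ge ?bnd_simp -?leNgt ?ltW//; exact: integrable_set0.
apply: measurable_bounded_integrable.
- exact: measurable_itv.
- by rewrite [ltLHS](lebesgue_stieltjes_itvoc W uv) ltry.
- exact: measurable_funS Wderiv_measurable.
- have [M MP] := Wderiv_bounded; exists M; split; rewrite ?num_real// => x Mx y.
  by move=> /= /uv01 y01; apply: le_trans (ltW Mx); exact: MP.
Qed.

Lemma LW_domain_increment u v : 0 <= u -> u <= v -> v <= 1 ->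
  P v - P u = \int[LS]_(y in `]u, v]) psi y.
Proof.
move=> u0 uv v1; pose h y := \int[mu]_(z in `[0, y]) ff z.
have mitv x y : measurable (`]x, y] : set (measurableTypeR R)).
  exact: measurable_itv.
have icst x y (k : R) : x <= y -> LS.-integrable `]x, y] (EFin \o cst k).
  move=> xy; apply: measurable_bounded_integrable => //.
    by rewrite [ltLHS](lebesgue_stieltjes_itvoc W xy) ltry.
  by exists `|k|; split; rewrite ?num_real// => z kz t _ /=; exact: ltW.
have ih x y : 0 <= x -> x <= y -> y <= 1 -> LS.-integrable `]x, y] (EFin \o h).
  move=> x0 xy y1.
  have := integrableB (mitv x y) (Wderiv_integrable x0 y1) (icst _ _ b xy).
  apply: eq_integrable => // z _ /=.
  by rewrite /psi -EFinB addrAC subrr add0r.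
have -> : \int[LS]_(y in `]u, v]) psi y =
    b * (W v - W u) + \int[LS]_(y in `]u, v]) h y.
  rewrite RintegralD//; [|exact: icst|exact: ih].
  by rewrite Rintegral_cst// [X in fine X](lebesgue_stieltjes_itvoc W uv).
rewrite /P (@itv_bndbnd_setU _ _ _ (BRight u))// Rintegral_setU//.
- by rewrite -/h; ring.
- rewrite -itv_bndbnd_setU//; apply: ih => //; exact: le_trans uv.
- apply/disj_setPS => x [/=]; rewrite !in_itv/= => /andP[_ xu] /andP[+ _].
  by rewrite ltNge xu.
Qed.

Lemma LW_domain_quotient u v (c e : R) : 0 <= u -> u < v -> v <= 1 ->
  (forall y, y \in `]u, v] -> `|psi y - c| <= e) ->
  `|(P v - P u) / (W v - W u) - c| <= e.
Proof.
move=> u0 uv v1 h; have [Winc _ _] := Wsp.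
have Wuv : 0 < W v - W u by rewrite subr_gt0; exact: Winc.
have muv : measurable (`]u, v] : set (measurableTypeR R)).
  exact: measurable_itv.
have icst (k : R) : LS.-integrable `]u, v] (EFin \o cst k).
  apply: measurable_bounded_integrable => //.
    by rewrite [ltLHS](lebesgue_stieltjes_itvoc W (ltW uv)) ltry.
  by exists `|k|; split; rewrite ?num_real// => x kx y _ /=; exact: ltW.
have E k : \int[LS]_(y in `]u, v]) k = k * (W v - W u).
  by rewrite Rintegral_cst// [X in fine X](lebesgue_stieltjes_itvoc W (ltW uv)).
rewrite (LW_domain_increment u0 (ltW uv) v1).
suff : `|\int[LS]_(y in `]u, v]) psi y - \int[LS]_(y in `]u, v]) c| <=
    \int[LS]_(y in `]u, v]) e.
  rewrite !E => H; rewrite -(ler_pM2r Wuv); apply: le_trans H.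
  rewrite -[X in _ * X](gtr0_norm Wuv) -normrM mulrBl divfK ?gt_eqF//.
rewrite -RintegralB//; [|exact: Wderiv_integrable|exact: icst].
have isub : LS.-integrable `]u, v] (EFin \o (fun y => psi y - c)).
  have := integrableB muv (Wderiv_integrable u0 v1) (icst c).
  by apply: eq_integrable.
apply: le_trans (le_normr_Rintegral _ isub) _ => //.
apply: le_Rintegral => //; last exact: icst.
exact: integrable_norm.
Qed.

Lemma LW_domain_bounded : exists M, forall x, x \in `[0, 1[ -> `|P x| <= M.
Proof.
have [M MP] := Wderiv_bounded.
have M0 : 0 <= M.
  by apply: le_trans (MP 0 _); rewrite ?normr_ge0// in_itv/= lexx ler01.
have [Winc _ _] := Wsp.
exists (`|P 0| + M * (W 1 - W 0)) => x; rewrite in_itv/= => /andP[x0 x1].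
have W01 : W 0 < W 1 by exact: Winc.
have [->|x0'] := eqVneq x 0.
  by rewrite lerDl mulr_ge0// subr_ge0 ltW.
have {}x0' : 0 < x by rewrite lt0r x0'.
have W0x : 0 < W x - W 0 by rewrite subr_gt0; exact: Winc.
have := @LW_domain_quotient 0 x 0 M (lexx _) x0' (ltW x1).
have /[swap]/[apply] : forall y, y \in `]0, x] -> `|psi y - 0| <= M.
  move=> y; rewrite in_itv/= subr0 => /andP[y0 yx]; apply: MP.
  by rewrite in_itv/= ltW//= (le_trans yx)// ltW.
rewrite subr0 normrM [`|_^-1|]gtr0_norm ?invr_gt0// ler_pdivrMr// => h.
rewrite -lerBlDl; apply: le_trans (lerB_dist _ _) _; apply: le_trans h _.
by apply: ler_wpM2l => //; rewrite lerD2r ltW//; exact: Winc.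
Qed.

Lemma Wderiv_continuous_at y e : y \in `[0, 1] -> 0 < e ->
  exists2 r, 0 < r & forall z, z \in `[0, 1] -> `|z - y| < r ->
    `|psi z - psi y| <= e.
Proof.
move=> y01 e0; have /subspace_continuousP/(_ y y01) := Wderiv_continuous.
move=> /cvgrPdist_le/(_ _ e0); rewrite near_withinE => /nbhs_ballP[r /= r0 h].
exists r => // z z01 zy; rewrite distrC; apply: h => //.
by rewrite /ball/= distrC.
Qed.

Lemma LW_domain_Wderivative x : x \in `[0, 1[ ->
  (P (torus_proj (x + h)) - P x) / (W (x + h) - W x) @[h --> 0^'] --> psi x.
Proof.
move=> x01; have [Winc _ Wper] := Wsp.
move: (x01); rewrite in_itv/= => /andP[x0 x1].
have P1 : P 1 = P 0.
  by apply/eqP; rewrite -subr_eq0 LW_domain_increment// P01.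
(* y is the point of ]0, 1] that represents the same point of the torus as x *)
have [y [y0 y1 [Py psiy yE]]] : exists y, [/\ 0 < y, y <= 1 &
    [/\ P y = P x, psi y = psi x & forall h, - y <= h -> h < 0 ->
      torus_proj (x + h) = y + h /\ W (x + h) - W x = W (y + h) - W y]].
  have [->|x0'] := eqVneq x 0.
    exists 1; rewrite P1 Wderiv_at0 Wderiv_at1.
    split=> //; split => // h h1 h0; split.
      rewrite add0r (@torus_projE _ _ (-1)); first by rewrite opprK addrC.
      by rewrite addNr h0 andbT.
    by rewrite add0r [1 + h]addrC; have := Wper h; lra.
  exists x; split; [by rewrite lt0r x0'|exact: ltW|split=> // h h1 h0].
  by rewrite torus_proj_id//; apply/andP; split; lra.
have y01 : y \in `[0, 1] by rewrite in_itv/= ltW.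
have x01' : x \in `[0, 1] by rewrite in_itv/= x0 ltW.
apply/cvgrPdist_le => e e0.
have [r r0 hr] := Wderiv_continuous_at x01' e0.
have [s s0 hs] := Wderiv_continuous_at y01 e0.
near=> h.
have hne : h != 0 by near: h; exact: nbhs_dnbhs_neq.
have hr' : `|h| < r by near: h; exact: dnbhs0_lt.
have hs' : `|h| < s by near: h; exact: dnbhs0_lt.
have hy : `|h| < y by near: h; exact: dnbhs0_lt.
have hx : `|h| < 1 - x by near: h; apply: dnbhs0_lt; rewrite subr_gt0.
rewrite distrC; move: hne; rewrite neq_lt => /orP[hlt|hgt].
  rewrite ltr0_norm// in hr' hs' hy hx.
  have [||-> ->] := yE h; [by lra|by []|].
  rewrite -Py -psiy -mulrNN -invrN !opprB.
  apply: LW_domain_quotient; [lra|lra|lra|move=> z].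
  rewrite in_itv/= => /andP[z1 z2].
  by apply: hs; [rewrite in_itv/=; lra|rewrite ltr_norml; lra].
rewrite gtr0_norm// in hr' hs' hy hx.
rewrite torus_proj_id; last by apply/andP; split; lra.
apply: LW_domain_quotient; [lra|lra|lra|move=> z].
rewrite in_itv/= => /andP[z1 z2].
by apply: hr; [rewrite in_itv/=; lra|rewrite ltr_norml; lra].
Unshelve. all: by end_near. Qed.

Lemma Wderiv_ae_derivative : {ae torus_dx R, forall x, x \in `[0, 1[ ->
  (psi (torus_proj (x + h)) - psi x) / (x + h - x) @[h --> 0^'] --> ff x}.
Proof.
apply: ae_torus_dx; pose g := ff \_ `[0, 1].
have igT : mu.-integrable setT (EFin \o g).
  by rewrite -restrict_EFin; apply/integrable_restrict => //=; rewrite setTI.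
have ig y : mu.-integrable `[0, y] (EFin \o g).
  by apply: integrableS igT.
have := FTC1 (a := BLeft 0) ig
  (integrable_locally_restrict (measurable_itv `[0, 1]) iff).
have n0 : {ae mu, forall x, x <> 0 :> R}.
  exists [set 0]; split => //; first exact: lebesgue_measure_set1.
  by move=> x /= /contrapT.
move: n0; apply: filterS2; first exact: (ae_filter_ringOfSetsType mu).
move=> x xn0 hx; rewrite in_itv/= => /andP[x0 x1].
have {}x0 : 0 < x by rewrite lt0r x0 andbT; exact/eqP.
have [] := hx; first by rewrite lte_fin.
rewrite [g x]patchE mem_set; last by rewrite /= in_itv/= !ltW.
set G := fun y => _ => dG <-.
have GE y : y <= 1 -> \int[mu]_(z in `[0, y]) ff z = G y.
  move=> y1; apply: eq_Rintegral => z; rewrite inE/= in_itv/= => /andP[z0 zy].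
  by rewrite /g patchE mem_set//= in_itv/= z0 (le_trans zy).
have : (fun h => h^-1 *: (G (h + x) - G x)) h @[h --> 0^'] --> derive1 G x.
  move: dG; rewrite /derivable /derive1.
  rewrite (_ : (fun h => _) = (fun h => h^-1 *: (G (h + x) - G x)))//.
  by apply/funext => h /=; rewrite [h%:A]mulr1.
apply: cvg_trans; apply: near_eq_cvg; near=> h.
have h1 : `|h| < x by near: h; exact: dnbhs0_lt.
have h2 : `|h| < 1 - x by near: h; apply: dnbhs0_lt; rewrite subr_gt0.
move: h1 h2; rewrite !ltr_norml => h1 h2.
rewrite torus_proj_id; last by apply/andP; split; lra.
rewrite /psi !GE; [|lra|lra].
rewrite addrC [x + h]addrC addrK /GRing.scale/= mulrC; congr (_ * _); ring.
Unshelve. all: by end_near. Qed.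

End LW_derivatives.

Section bounded_measurable.
Context {d} {T : measurableType d} {R : realType}.
Implicit Types f g : T -> R.

Definition bounded_measurable f :=
  measurable_fun setT f /\ exists M, forall x, `|f x| <= M.

Lemma Lfun2s_bounded (mu : {finite_measure set T -> \bar R}) f :
  bounded_measurable f -> Lfun2s mu f.
Proof. by move=> [mf [M fM]]; exact: Lfun2_bounded fM. Qed.

Lemma bounded_measurable_cst c : bounded_measurable (fun=> c).
Proof. by split => //; exists `|c|. Qed.

Lemma bounded_measurableD f g : bounded_measurable f -> bounded_measurable g ->
  bounded_measurable (fun x => f x + g x).
Proof.
move=> [mf [M fM]] [mg [N gN]]; split; first exact: measurable_funD.
by exists (M + N) => x; rewrite (le_trans (ler_normD _ _))// lerD.
Qed.

Lemma bounded_measurableM f g : bounded_measurable f -> bounded_measurable g ->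
  bounded_measurable (fun x => f x * g x).
Proof.
move=> [mf [M fM]] [mg [N gN]]; split; first exact: measurable_funM.
by exists (M * N) => x; rewrite normrM ler_pM.
Qed.

Lemma bounded_measurable_sum (I : Type) (r : seq I) (F : I -> T -> R) :
  (forall i, bounded_measurable (F i)) ->
  bounded_measurable (fun x => \sum_(i <- r) F i x).
Proof.
move=> bF; elim: r => [|i r IH].
  by under eq_fun do rewrite big_nil; exact: bounded_measurable_cst.
by under eq_fun do rewrite big_cons; exact: bounded_measurableD.
Qed.

Lemma bounded_measurable_prod (I : Type) (r : seq I) (P : pred I)
    (F : I -> T -> R) : (forall i, bounded_measurable (F i)) ->
  bounded_measurable (fun x => \prod_(i <- r | P i) F i x).
Proof.
move=> bF; elim: r => [|i r IH].
  by under eq_fun do rewrite big_nil; exact: bounded_measurable_cst.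
have [Pi|/negbTE Pi] := boolP (P i); last first.
  by under eq_fun do rewrite big_cons Pi.
by under eq_fun do rewrite big_cons Pi; exact: bounded_measurableM.
Qed.

End bounded_measurable.

Lemma bounded_measurable_tnth {R : realType} n (f : measurableTypeR R -> R)
    (k : 'I_n) : bounded_measurable f ->
  bounded_measurable (fun x : n.-tuple (measurableTypeR R) => f (tnth x k)).
Proof.
move=> [mf [M fM]]; split; last by exists M.
by apply: (measurableT_comp mf); exact: measurable_tnth.
Qed.

Lemma bounded_measurable_patch {R : realType} (f : measurableTypeR R -> R)
    (D : set (measurableTypeR R)) M : measurable D ->
  measurable_fun D f -> (forall x, D x -> `|f x| <= M) ->
  bounded_measurable (f \_ D).
Proof.
move=> mD mf fM; split; first exact/(measurable_restrictT _ _).1.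
exists (Num.max M 0) => x; rewrite patchE le_max.
by case: ifPn => [/set_mem/fM ->//|_]; rewrite normr0 lexx orbT.
Qed.

Lemma LW_graph_derivatives {R : realType} (W : cumulative R R) (f ff : R -> R) :
  strict_periodic_increments W -> LW_graph W f ff ->
  bounded_measurable (f \_ `[0, 1[ : measurableTypeR R -> R) /\
  exists psi, [/\ bounded_measurable (psi : measurableTypeR R -> R),
    forall x, x \in `[0, 1[ ->
      (f (torus_proj (x + h)) - f x) / (W (x + h) - W x) @[h --> 0^']
        --> psi x &
    {ae torus_dx R, forall x, x \in `[0, 1[ ->
      (psi (torus_proj (x + h)) - psi x) / (x + h - x) @[h --> 0^'] --> ff x}].
Proof.
move=> Wsp [Lf Lff ff0 [a [b [P01 fE]]]].
have iff := integrable_torus_dx Lff.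
have {}ff0 : \int[@lebesgue_measure R]_(z in `[0, 1]) ff z = 0.
  rewrite -Rintegral_itv_bndo_bndc -?Rintegral_torus_dx//.
  by apply: integrableS iff => //; apply: subset_itvl; rewrite bnd_simp.
have mI : measurable (`[0, 1[ : set (measurableTypeR R)).
  exact: measurable_itv.
split.
  have [M PM] := LW_domain_bounded a b Wsp iff.
  apply: (@bounded_measurable_patch _ _ _ M) => //.
    by apply: measurable_funTS; exact: Lfun2_measurable Lf.
  by move=> x xI; rewrite fE//; exact: PM.
pose psi0 y := b + \int[@lebesgue_measure R]_(z in `[0, y]) ff z.
exists (psi0 \_ `[0, 1[); split.
- have [M PM] := Wderiv_bounded b iff.
  have sI : `[0%R : R, 1%R[%classic `<=` `[0, 1]%classic.
    by apply: subset_itvl; rewrite bnd_simp.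
  apply: (@bounded_measurable_patch _ _ _ M) => //.
    exact: measurable_funS (Wderiv_measurable b iff).
  by move=> x /sI xI; exact: PM.
- move=> x xI; rewrite patchE mem_set//.
  have := LW_domain_Wderivative a Wsp iff ff0 P01 xI.
  by under eq_fun do rewrite -!fE ?torus_proj_itv//.
- have := Wderiv_ae_derivative b iff.
  apply: filterS; first exact: (ae_filter_ringOfSetsType (torus_dx R)).
  have E y : y \in `[0, 1[ -> (psi0 \_ `[0, 1[) y = psi0 y.
    by move=> yI; rewrite patchE mem_set.
  move=> x h xI; under eq_fun do rewrite !E ?torus_proj_itv//.
  exact: h.
Qed.

Lemma tuple_measure_ae {dT} {T : measurableType dT} {R : realType} n
    (mu : 'I_n -> {finite_measure set T -> \bar R}) (k : 'I_n) (P : T -> Prop) :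
  {ae mu k, forall x, P x} -> {ae tuple_measure mu, forall x, P (tnth x k)}.
Proof.
move=> [N [mN N0 PN]]; pose B j := if j == k then N else setT.
have mB j : measurable (B j) by rewrite /B; case: ifP.
exists ((fun x : n.-tuple T => tnth x k) @^-1` N); split.
- rewrite -[X in measurable X]setTI; exact: measurable_tnth.
- have -> : (fun x : n.-tuple T => tnth x k) @^-1` N =
      [set x | forall j, B j (tnth x j)].
    apply/seteqP; split=> x /= h => [j|].
      by rewrite /B; case: eqP => [->|].
    by have := h k; rewrite /B eqxx.
  by rewrite tuple_measureE// (bigD1 k)//= /B eqxx N0 mul0e.
- by move=> x; exact: PN.
Qed.

Section gderiv.
Context {R : realType} {d : nat}.
Local Notation point := (d.-tuple (measurableTypeR R)).

Definition torus_points : set point := [set x | forall k, tnth x k \in `[0, 1[].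

Lemma tuple_measure_torus_points (V : 'I_d -> cumulative R R) :
  {ae tuple_measure (fun k => torus_measure (V k)), forall x, torus_points x}.
Proof.
apply: filter_forall => k.
exact: (@tuple_measure_ae _ _ _ _ _ k _ (torus_measure_ae (V k))).
Qed.

Lemma tnth_torus_shift i e (x : point) k : tnth (torus_shift i e x) k =
  if k == i then torus_proj (tnth x k + e) else tnth x k.
Proof. by rewrite tnth_mktuple. Qed.

Lemma torus_shift_points i e (x : point) : torus_points x ->
  torus_points (torus_shift i e x).
Proof.
move=> xI k; rewrite tnth_torus_shift; case: ifP => _; last exact: xI.
exact: torus_proj_itv.
Qed.

Lemma gderiv_sum_prod (V : R -> R) i (f : point -> R) n (c : 'I_n -> R)
    (chi : 'I_n -> R -> R) (phi : 'I_n -> 'I_d -> R -> R) (x : point)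
    (l : 'I_n -> R) :
  (forall y, torus_points y -> f y = \sum_(j < n)
     c j * (chi j (tnth y i) * \prod_(k < d | k != i) phi j k (tnth y k))) ->
  torus_points x ->
  (forall j, (chi j (torus_proj (tnth x i + e)) - chi j (tnth x i)) /
    (V (tnth x i + e) - V (tnth x i)) @[e --> 0^'] --> l j) ->
  gderiv V i f x =
    \sum_(j < n) c j * (l j * \prod_(k < d | k != i) phi j k (tnth x k)).
Proof.
move=> fE xI chil; apply/cvg_lim => //.
have -> : (fun e => (f (torus_shift i e x) - f x) /
      (V (tnth x i + e) - V (tnth x i))) =
    (fun e => \sum_(j < n) c j *
     ((chi j (torus_proj (tnth x i + e)) - chi j (tnth x i)) /
      (V (tnth x i + e) - V (tnth x i)) *
      \prod_(k < d | k != i) phi j k (tnth x k))).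
  apply/funext => e; rewrite !fE//; last exact: torus_shift_points.
  rewrite -sumrB mulr_suml; apply: eq_bigr => j _.
  rewrite tnth_torus_shift eqxx.
  have -> : \prod_(k < d | k != i) phi j k (tnth (torus_shift i e x) k) =
      \prod_(k < d | k != i) phi j k (tnth x k).
    by apply: eq_bigr => k /negbTE ki; rewrite tnth_torus_shift ki.
  by ring.
apply: cvg_big => [|j _]; first exact: add_continuous.
by apply: cvgMl_tmp; apply: cvgMr_tmp; exact: chil.
Qed.

End gderiv.

Lemma DW_gderiv_Lfun2 (R : realType) (d : nat)
    (W : 'I_d -> cumulative R R) (A : 'I_d -> set (R -> R))
    (hW : forall k, strict_periodic_increments (W k))
    (hA : forall k, eigenbasis (W k) (A k)) (i : 'I_d) f : DW A f ->
  exists p q, [/\ Lfun2s (dx d) p, Lfun2s (dxW W i) q,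
    forall g, \int[dx d]_x (gderiv idfun i (gderiv (W i) i f) x * g x) =
      ipL2 (dx d) p g &
    forall G, \int[dxW W i]_x (gderiv (W i) i f x * G x) = ipL2 (dxW W i) q G].
Proof.
move=> [n [c [u [Au fE0]]]].
have /choice[phi phiP] j : exists phi, (forall k, A k (phi k)) /\
    u j = fun x => \prod_(k < d) phi k (tnth x k).
  by have [phi Aphi uE] := Au j; exists phi.
have eig j k : LW_eigenvector (W k) (phi j k).
  by have [_ h _ _ _] := hA k; apply: h; exact: (phiP j).1.
pose Phi j k := phi j k \_ `[0%R, 1%R[.
have bPhi j k : bounded_measurable (Phi j k : measurableTypeR R -> R).
  by have [[lam [ff /(LW_graph_derivatives (hW k))[]]]] := eig j k.
have PhiE j k x : x \in `[0, 1[ -> Phi j k x = phi j k x.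
  by move=> xI; rewrite /Phi patchE mem_set.
have /choice[psi psiP] j : exists psi, [/\
    bounded_measurable (psi : measurableTypeR R -> R),
    forall x, x \in `[0, 1[ ->
      (Phi j i (torus_proj (x + h)) - Phi j i x) / (W i (x + h) - W i x)
        @[h --> 0^'] --> psi x &
    exists lam, {ae torus_dx R, forall x, x \in `[0, 1[ ->
      (psi (torus_proj (x + h)) - psi x) / (x + h - x) @[h --> 0^']
        --> lam * Phi j i x}].
  have [[lam [ff ffG ffE]] _] := eig j i.
  have [_ [psi [bpsi psi1 psi2]]] := LW_graph_derivatives (hW i) ffG.
  exists psi; split => // [x xI|].
    under eq_fun do rewrite !PhiE ?torus_proj_itv//.
    exact: psi1.
  exists lam; move: ffE psi2; apply: filterS2.
    exact: (ae_filter_ringOfSetsType (torus_dx R)).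
  by move=> x ffx h xI; rewrite PhiE// -ffx; exact: h.
have /choice[lam lamP] j : exists lam, {ae torus_dx R, forall x,
    x \in `[0, 1[ ->
    (psi j (torus_proj (x + h)) - psi j x) / (x + h - x) @[h --> 0^']
      --> lam * Phi j i x} by have [] := psiP j.
pose E (x : d.-tuple (measurableTypeR R)) j :=
  \prod_(k < d | k != i) Phi j k (tnth x k).
pose q (x : d.-tuple (measurableTypeR R)) :=
  \sum_(j < n) c j * (psi j (tnth x i) * E x j).
pose p (x : d.-tuple (measurableTypeR R)) :=
  \sum_(j < n) c j * (lam j * Phi j i (tnth x i) * E x j).
have bE j : bounded_measurable (E ^~ j).
  by apply: bounded_measurable_prod => k; exact: bounded_measurable_tnth.
have bq : bounded_measurable q.
  apply: bounded_measurable_sum => j.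
  apply: bounded_measurableM; first exact: bounded_measurable_cst.
  apply: bounded_measurableM => //; apply: bounded_measurable_tnth.
  by have [] := psiP j.
have bp : bounded_measurable p.
  apply: bounded_measurable_sum => j.
  apply: bounded_measurableM; first exact: bounded_measurable_cst.
  apply: bounded_measurableM; last exact: bE.
  apply: bounded_measurableM; first exact: bounded_measurable_cst.
  exact: bounded_measurable_tnth.
have fE x : torus_points x ->
    f x = \sum_(j < n) c j * (Phi j i (tnth x i) * E x j).
  move=> xI; rewrite fE0; apply: eq_bigr => j _.
  rewrite (phiP j).2 (bigD1 i)//=.
  rewrite PhiE//; congr (_ * (_ * _)).
  by apply: eq_bigr => k _; rewrite PhiE.
have qE x : torus_points x -> gderiv (W i) i f x = q x.
  move=> xI; apply: (gderiv_sum_prod (chi := fun j => Phi j i) fE) => // j.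
  by have [_ h _] := psiP j; exact: (h _ (xI i)).
have pE : {ae dx d, forall x, gderiv idfun i (gderiv (W i) i f) x = p x}.
  have H : {ae dx d, forall x : d.-tuple (measurableTypeR R), forall j,
      tnth x i \in `[0, 1[ ->
      (psi j (torus_proj (tnth x i + h)) - psi j (tnth x i)) /
      (tnth x i + h - tnth x i) @[h --> 0^'] --> lam j * Phi j i (tnth x i)}.
    apply: filter_forall => j.
    exact: (@tuple_measure_ae _ _ _ _ _ i _ (lamP j)).
  have TP : {ae dx d, forall x : d.-tuple (measurableTypeR R), torus_points x}.
    exact: (tuple_measure_torus_points (fun=> [the cumulative R R of idfun])).
  move: TP H.
  apply: filterS2.
  move=> x xI h; apply: (gderiv_sum_prod (chi := psi) qE) => // j.
  exact: (h j (xI i)).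
exists p, q; split.
- exact: Lfun2s_bounded.
- exact: Lfun2s_bounded.
- move=> g; apply: ae_eq_RintegralT; move: pE.
  apply: filterS.
  by move=> x ->.
- move=> G; apply: ae_eq_RintegralT.
  have TP : {ae dxW W i, forall x, torus_points x}.
    exact: (tuple_measure_torus_points
      (fun k => if k == i then W k else [the cumulative R R of idfun])).
  move: TP.
  apply: filterS.
  by move=> x /qE ->.
Qed.

Theorem lemma2p10 (R : realType) (d : nat) (d_gt0 : (0 < d)%N)
    (W : 'I_d -> cumulative R R) (A : 'I_d -> set (R -> R))
    (hW : forall k, strict_periodic_increments (W k))
    (hA : forall k, eigenbasis (W k) (A k))
    (F : (d.-tuple (measurableTypeR R) -> R) -> R) :
  (Hm1W W A F <-> exists f0 f, represents W A F f0 f) /\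
  (Hm1W W A F ->
    normHm1W W A F =
    inf [set r | exists f0 f, represents W A F f0 f /\ r = repr_norm W f0 f]).
Proof.
pose TP i p q := [/\ Lfun2s (dx d) p, Lfun2s (dxW W i) q & exists2 f, DW A f &
  (forall g, \int[dx d]_x (gderiv idfun i (gderiv (W i) i f) x * g x) =
    ipL2 (dx d) p g) /\
  (forall G, \int[dxW W i]_x (gderiv (W i) i f x * G x) =
    ipL2 (dxW W i) q G)].
apply: (@dualS_repr _ _ R d (dx d) (dxW W) (weak_deriv W A) TP).
  by move=> i p q [].
move=> i g G.
have G1 : ipL2 (dxW W i) (cst 1) G = \int[dxW W i]_x G x.
  by apply: eq_Rintegral => x _; rewrite mul1r.
rewrite G1; split=> [[[LG G0] h]|[LG G0 h]].
  by split => // p q [_ _ [f fDW [<- <-]]]; exact: h.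
split=> // f fDW; have [p [q [Lp Lq pE qE]]] := DW_gderiv_Lfun2 hW hA i fDW.
by rewrite pE qE; apply: h; split => //; exists f.
Qed.
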